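(* For every state $\rho_{AB}$ on a finite-dimensional system $\mathcal{H}_A\otimes\mathcal{H}_B$, $$2E^C_{\rm sq}(\rho_{AB})\ \ge\ 2\big(E^C_{\rm sq}\big)^{(\infty)}(\rho_{AB})\ \ge\ I_b^{(\infty)}(\rho_{AB})\ \ge\ 2E_I(\rho_{AB})\ \ge\ 2E^Q_{\rm sq}(\rho_{AB}).$$
   Context: Mutual information $I(X:Y)_\rho=S(X)+S(Y)-S(XY)$ (von Neumann entropies, base 2). An extension of $\rho_{AB}$ is a state on $AB$ plus further systems whose reduced state on $AB$ is $\rho_{AB}$. Squashed entanglement: $E^Q_{\rm sq}(\rho_{AB})=\frac12\inf_{\rho_{ABE}}\big(I(A:BE)_\rho-I(A:E)_\rho\big)$ over all extensions $\rho_{ABE}$. Conditional entanglement of mutual information: $E_I(\rho_{AB})=\frac12\inf_{\rho_{ABA'B'}}\big(I(AA':BB')_\rho-I(A':B')_\rho\big)$ over all extensions $\rho_{ABA'B'}$. Classical squashed entanglement: $E^C_{\rm sq}(\rho_{AB})=\frac12\min\big(I(A:B\hat E)_\rho-I(A:\hat E)_\rho\big)$ over extensions of the form $\rho_{AB\hat E}=\sum_kp_k\rho^k_{AB}\otimes|k\rangle\langle k|_{\hat E}$ (classical on $\hat E$). The regularization is $(E^C_{\rm sq})^{(\infty)}(\rho_{AB})=\lim_n\frac1nE^C_{\rm sq}(\rho_{AB}^{\otimes n})$ (with $\rho_{AB}^{\otimes n}$ viewed as a state of $A^n$ versus $B^n$). An $n$-copy broadcast state of $\rho_{AB}$ is a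 state on $A_1B_1\cdots A_nB_n$ whose reduced state on each $A_kB_k$ is $\rho_{AB}$; $(I_b)_n(\rho_{AB})$ is the minimum of $I(A_1\cdots A_n:B_1\cdots B_n)$ over such states and $I_b^{(\infty)}=\lim_n\frac1n(I_b)_n$. *)

(* Defs.v *)
(* Quantum states on finite systems are
   represented as operators  T -> T -> R[i]  on the Hilbert space C^T, where
   T is a finite type (an orthonormal basis label set) and R : realType. *)
From HB Require Import structures.
From mathcomp Require Import all_boot all_order all_algebra.
From mathcomp Require Import complex.
From mathcomp Require Import all_classical all_reals all_analysis.

Set Implicit Arguments.
Unset Strict Implicit.
Unset Printing Implicit Defensive.

Import Order.TTheory GRing.Theory Num.Theory numFieldNormedType.Exports.
Local Open Scope ring_scope.
Local Open Scope classical_set_scope.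

Section QuantumInfo.
Variable R : realType.
Local Notation C := R[i].

(* operators on the Hilbert space C^T (matrix entries <x|rho|y>) *)
Definition op (T : finType) := T -> T -> C.

Definition trace (T : finType) (rho : op T) : C := \sum_x rho x x.

Definition hermitian (T : finType) (rho : op T) : Prop :=
  forall x y, rho y x = conjc (rho x y).

(* positive semidefinite: <v|rho|v> >= 0 (real and nonnegative in C) *)
Definition psd (T : finType) (rho : op T) : Prop :=
  forall v : T -> C, 0 <= \sum_x \sum_y conjc (v x) * rho x y * v y.

Definition is_state (T : finType) (rho : op T) : Prop :=
  [/\ hermitian rho, psd rho & trace rho = 1].

(* spectral decomposition rho = sum_i p_i |u_i><u_i| with (u_i)_i an
   orthonormal basis of C^T ; u x i is the x-th coordinate of u_i *)
Definition spectral_decomp (T : finType) (rho : op T) (p : T -> R)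
    (u : T -> T -> C) : Prop :=
  (forall i j, \sum_x conjc (u x i) * u x j = (i == j)%:R) /\
  (forall x y, rho x y = \sum_i (p i)%:C%C * u x i * conjc (u y i)).

Definition shannon2 (T : finType) (p : T -> R) : R :=
  - \sum_i (if p i == 0 then 0 else p i * (ln (p i) / ln 2)).

(* von Neumann entropy S(rho) = - tr rho log2 rho, i.e. the Shannon entropy of
   the eigenvalues (independent of the chosen spectral decomposition). *)
Definition vN (T : finType) (rho : op T) : R :=
  sup [set s : R | exists p u, spectral_decomp rho p u /\ s = shannon2 p].

Definition trR (T1 T2 : finType) (rho : op (prod T1 T2)) : op T1 :=
  fun a a' => \sum_b rho (a, b) (a', b).
Definition trL (T1 T2 : finType) (rho : op (prod T1 T2)) : op T2 :=
  fun b b' => \sum_a rho (a, b) (a, b').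

Definition MI (T1 T2 : finType) (rho : op (prod T1 T2)) : R :=
  vN (trR rho) + vN (trL rho) - vN rho.

Definition assocr (T1 T2 T3 : finType) (rho : op (prod (prod T1 T2) T3))
  : op (prod T1 (prod T2 T3)) :=
  fun x y => rho ((x.1, x.2.1), x.2.2) ((y.1, y.2.1), y.2.2).

Definition trmid (T1 T2 T3 : finType) (rho : op (prod (prod T1 T2) T3))
  : op (prod T1 T3) :=
  fun x y => \sum_b rho ((x.1, b), x.2) ((y.1, b), y.2).

Definition regroup (T1 T2 T3 T4 : finType) (rho : op (prod (prod T1 T2) (prod T3 T4)))
  : op (prod (prod T1 T3) (prod T2 T4)) :=
  fun x y => rho ((x.1.1, x.2.1), (x.1.2, x.2.2))
                 ((y.1.1, y.2.1), (y.1.2, y.2.2)).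

Definition is_ext (A B E : finType) (rhoAB : op (prod A B))
    (sigma : op (prod (prod A B) E)) : Prop :=
  is_state sigma /\ trR sigma = rhoAB.

Definition sq_obj (A B E : finType) (sigma : op (prod (prod A B) E)) : R :=
  MI (assocr sigma) - MI (trmid sigma).

Definition EsqQ (A B : finType) (rho : op (prod A B)) : R :=
  inf [set x : R | exists (E : finType) (sigma : op (prod (prod A B) E)),
         is_ext rho sigma /\ x = sq_obj sigma] / 2.

Definition EI_obj (A B A' B' : finType) (sigma : op (prod (prod A B) (prod A' B'))) : R :=
  MI (regroup sigma) - MI (trL sigma).

Definition EI (A B : finType) (rho : op (prod A B)) : R :=
  inf [set x : R | exists (A' B' : finType) (sigma : op (prod (prod A B) (prod A' B'))),
         is_ext rho sigma /\ x = EI_obj sigma] / 2.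

(* classical-quantum extension  sum_k p_k rho^k (x) |k><k| *)
Definition cq_state (A B K : finType) (p : K -> R) (sig : K -> op (prod A B))
  : op (prod (prod A B) K) :=
  fun x y => if x.2 == y.2 then (p x.2)%:C%C * sig x.2 x.1 y.1 else 0.

Definition EsqC (A B : finType) (rho : op (prod A B)) : R :=
  inf [set x : R | exists (K : finType) (p : K -> R) (sig : K -> op (prod A B)),
         [/\ (forall k, 0 <= p k), \sum_k p k = 1,
             (forall k, is_state (sig k)),
             is_ext rho (cq_state p sig)
           & x = sq_obj (cq_state p sig)]] / 2.

Definition tpow (A B : finType) (rho : op (prod A B)) (n : nat)
  : op (prod {ffun 'I_n -> A} {ffun 'I_n -> B}) :=
  fun x y => \prod_(i < n) rho (x.1 i, x.2 i) (y.1 i, y.2 i).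

Definition EsqC_seq (A B : finType) (rho : op (prod A B)) (n : nat) : R :=
  EsqC (tpow (n := n) rho) / n%:R.
Definition EsqC_reg (A B : finType) (rho : op (prod A B)) : R :=
  limn (EsqC_seq rho).

Definition upd (A : finType) (n : nat) (f : {ffun 'I_n -> A}) (k : 'I_n) (a : A)
  : {ffun 'I_n -> A} := [ffun j => if j == k then a else f j].

Definition marg (A B : finType) (n : nat)
    (sigma : op (prod {ffun 'I_n -> A} {ffun 'I_n -> B})) (k : 'I_n) : op (prod A B) :=
  fun x y => \sum_(f : {ffun 'I_n -> A} | f k == x.1)
             \sum_(g : {ffun 'I_n -> B} | g k == x.2)
               sigma (f, g) (upd f k y.1, upd g k y.2).

Definition is_broadcast (A B : finType) (rho : op (prod A B)) (n : nat)
    (sigma : op (prod {ffun 'I_n -> A} {ffun 'I_n -> B})) : Prop :=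
  is_state sigma /\ forall k : 'I_n, marg sigma k = rho.

Definition Ib_n (A B : finType) (rho : op (prod A B)) (n : nat) : R :=
  inf [set x : R | exists sigma : op (prod {ffun 'I_n -> A} {ffun 'I_n -> B}), is_broadcast rho sigma /\ x = MI sigma].
Definition Ib_seq (A B : finType) (rho : op (prod A B)) (n : nat) : R :=
  Ib_n rho n / n%:R.
Definition Ib_reg (A B : finType) (rho : op (prod A B)) : R :=
  limn (Ib_seq rho).

End QuantumInfo.

(* Main.v *)
(** The four inequalities rest on strong subadditivity.  For states with
    eigenpairs (p_j, u_j) and (q_i, w_i), the sum over i, j of
    |<w_i|u_j>|^2 p_j^2 / (q_i + t p_j) is the maximum over operators X of
    2 Re tr(X^+ rho) - tr(X^+ sigma X) - t tr(X rho X^+); restricting X to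
    operators of the form Y (x) 1 shows that it decreases under partial trace.
    Integrating over t > 0 turns it into the relative entropy, and the case
    sigma = 1 (x) rho_BC is strong subadditivity.

    E_sq^C is the convex roof of the mutual information.  A decomposition
    sum_k p_k rho^k of rho^(x)m yields n-copy broadcast states: put rho^k in
    about n p_k of the n positions, fix the rounding errors in the at most |K|
    remaining ones, and average over the n cyclic shifts, which costs only
    2 log n.  Conversely, the mutual information of a broadcast state telescopes
    into n terms, each of which is the objective of an extension in E_I; and for
    any such extension the objective of E_I exceeds the one of E_sq^Q with
    E = A'B' by I(A:B'|A') + I(A':B|B') >= 0.  Fekete's lemma gives the limits. *)
Require Import Defs.
From HB Require Import structures.
From mathcomp Require Import all_boot all_order all_algebra.
From mathcomp Require Import complex.
From mathcomp Require Import all_classical all_reals all_analysis.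
From mathcomp Require Import ring lra.
Import Order.TTheory GRing.Theory Num.Theory numFieldNormedType.Exports.
Local Open Scope ring_scope.
Set Implicit Arguments.
Unset Strict Implicit.
Unset Printing Implicit Defensive.

Local Notation Re := complex.Re.
Local Notation Im := complex.Im.

(** * Spectral decompositions *)

(** Mutual information is not convex; under mixing it exceeds the average by at most twice the
    entropy of the weights. Filling n positions independently with random [rho^k] and forgetting the
    choices would allow an excess linear in n. Fixing in advance how often each [rho^k] occurs
    leaves only n shifts to mix, so the excess is logarithmic and disappears after division by n.
    The order of the limits matters: m and a decomposition of the m-fold power, hence |K| and the
    trivial bound on the mutual information of its members, stay fixed while n grows; the infimum
    over decompositions comes next, and m grows last. Every optimum is treated as an infimum, by
    bounding each competitor. The quadratic functional of X is finite without support conditions: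
    for t > 0 a vanishing denominator forces p_j = 0. Conditions on supports enter only with the
    logarithms. *)

Section Spectral.
Variable R : realType.
Local Notation C := R[i].

Definition sqn (z : C) : R := Re z ^+ 2 + Im z ^+ 2.

Lemma sqn_ge0 z : 0 <= sqn z.
Proof. by rewrite addr_ge0 ?sqr_ge0. Qed.

Lemma mulcJ z : z * conjc z = (sqn z)%:C%C.
Proof.
case: z => a b; rewrite /sqn; apply/eqP; rewrite eq_complex /=.
by apply/andP; split; apply/eqP; ring.
Qed.

Lemma mulJc z : conjc z * z = (sqn z)%:C%C.
Proof. by rewrite mulrC mulcJ. Qed.

Lemma sqnJ z : sqn (conjc z) = sqn z.
Proof. by case: z => a b; rewrite /sqn /= sqrrN. Qed.

Lemma sqnM x y : sqn (x * y) = sqn x * sqn y.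
Proof. by case: x => a b; case: y => c d; rewrite /sqn /=; ring. Qed.

Lemma sqn_real (a : R) : sqn a%:C%C = a ^+ 2.
Proof. by rewrite /sqn /= expr0n addr0. Qed.

Lemma complexRe_real (a : R) : Re (a%:C%C) = a. Proof. by []. Qed.

Lemma complexReD (x y : C) : Re (x + y) = Re x + Re y.
Proof. by case: x => a b; case: y. Qed.

Lemma complexRe_mulr (a : R) (x : C) : Re (a%:C%C * x) = a * Re x.
Proof. by case: x => b c; rewrite /= mul0r subr0. Qed.

Lemma complexRe_sum (I : Type) (r : seq I) (P : pred I) (F : I -> C) :
  Re (\sum_(i <- r | P i) F i) = \sum_(i <- r | P i) Re (F i).
Proof. exact: (big_morph _ complexReD). Qed.

Lemma real_complex_sum (I : Type) (r : seq I) (P : pred I) (F : I -> R) :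
  ((\sum_(i <- r | P i) F i)%:C)%C = \sum_(i <- r | P i) ((F i)%:C)%C.
Proof. exact: rmorph_sum. Qed.

Lemma conjcM (x y : C) : conjc (x * y) = conjc x * conjc y.
Proof. exact: rmorphM. Qed.

Lemma conjc_sum (I : Type) (r : seq I) (P : pred I) (F : I -> C) :
  conjc (\sum_(i <- r | P i) F i) = \sum_(i <- r | P i) conjc (F i).
Proof. exact: rmorph_sum. Qed.

Lemma sum_delta (V : pzSemiRingType) (T : finType) (j : T) (F : T -> V) :
  \sum_i (i == j)%:R * F i = F j.
Proof.
rewrite (bigD1 j) //= eqxx mul1r big1 ?addr0 // => i /negbTE ->.
by rewrite mul0r.
Qed.

Lemma sum_deltal (V : pzSemiRingType) (T : finType) (j : T) (F : T -> V) :
  \sum_i (j == i)%:R * F i = F j.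
Proof. by rewrite -[RHS]sum_delta; apply: eq_bigr => i _; rewrite eq_sym. Qed.

Definition ip (T : finType) (f g : T -> C) : C := \sum_x conjc (f x) * g x.

Lemma ipJ (T : finType) (f g : T -> C) : conjc (ip f g) = ip g f.
Proof.
by rewrite /ip conjc_sum; apply: eq_bigr => x _; rewrite conjcM conjcK mulrC.
Qed.

Definition orthobasis (T : finType) (u : T -> T -> C) :=
  forall i j, \sum_x conjc (u x i) * u x j = (i == j)%:R.

(** A left inverse of a square matrix is also a right inverse, so orthonormality of the columns
    gives that of the rows. *)
Lemma orthobasis_complete (T : finType) (u : T -> T -> C) : orthobasis u ->
  forall x y, \sum_i u x i * conjc (u y i) = (x == y)%:R.
Proof.
move=> ou x y.
pose M := \matrix_(i < #|T|, x < #|T|) conjc (u (enum_val x) (enum_val i)).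
pose N := \matrix_(x < #|T|, i < #|T|) u (enum_val x) (enum_val i).
have MN : M *m N = 1%:M.
  apply/matrixP => i j; rewrite !mxE -(inj_eq enum_val_inj) -ou.
  rewrite [RHS](reindex (@enum_val T T)) /=; last exact/onW_bij/enum_val_bij.
  by apply: eq_bigr => k _; rewrite !mxE.
have /matrixP/(_ (enum_rank x) (enum_rank y)) := mulmx1C MN.
rewrite !mxE (inj_eq enum_rank_inj) => <-.
rewrite (reindex (@enum_val T T)) /=; last exact/onW_bij/enum_val_bij.
by apply: eq_bigr => k _; rewrite !mxE !enum_rankK.
Qed.

Lemma parseval (T : finType) (u : T -> T -> C) (v : T -> C) : orthobasis u ->
  \sum_i sqn (ip (u^~ i) v) = \sum_x sqn (v x).
Proof.
move=> ou; apply: complexI; rewrite !real_complex_sum.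
transitivity (\sum_i \sum_x \sum_y (u y i * conjc (u x i)) * (v x * conjc (v y))).
  apply: eq_bigr => i _; rewrite -mulcJ ipJ /ip mulr_suml; apply: eq_bigr => x _.
  rewrite mulr_sumr; apply: eq_bigr => y _; ring.
rewrite exchange_big; apply: eq_bigr => x _; rewrite exchange_big /=.
transitivity (\sum_y (y == x)%:R * (v x * conjc (v y))).
  by apply: eq_bigr => y _; rewrite -mulr_suml orthobasis_complete.
by rewrite sum_delta mulcJ.
Qed.

(** The spectral theorem for normal matrices, transported along [enum_val]. In A = P^-1 D P with P
    unitary, the eigenvectors are the conjugated rows of P. *)
Lemma spectral_exists (T : finType) (rho : op R T) :
  Defs.hermitian rho -> exists p u, spectral_decomp rho p u.
Proof.
move=> hrho.
pose A : 'M[C]_#|T| := \matrix_(i, j) rho (enum_val i) (enum_val j).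
have hA : A \is hermsymmx.
  rewrite qualifE /=; apply/eqP; rewrite expr0 scale1r.
  by apply/matrixP => i j; rewrite !mxE hrho.
have rA := hermitian_spectral_diag_real hA.
have /orthomx_spectralP AE := hermitian_normalmx hA.
have uP := spectral_unitarymx A.
set P := spectralmx A in AE uP *; set d := spectral_diag A in AE rA *.
exists (fun i => Re (d 0 (enum_rank i))).
exists (fun x i => conjc (P (enum_rank i) (enum_rank x))).
split=> [i j|x y].
  move/unitarymxP/matrixP: uP => /(_ (enum_rank i) (enum_rank j)).
  rewrite !mxE (inj_eq enum_rank_inj) => <-.
  rewrite (reindex (@enum_val T T)) /=; last exact/onW_bij/enum_val_bij.
  by apply: eq_bigr => k _; rewrite !mxE conjcK enum_valK.
have := congr1 (fun M : 'M[C]_#|T| => M (enum_rank x) (enum_rank y)) AE.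
rewrite invmx_unitary // !mxE !enum_rankK => ->.
rewrite (reindex (@enum_val T T)) /=; last exact/onW_bij/enum_val_bij.
apply: eq_bigr => k _.
rewrite mul_mx_diag !mxE enum_valK conjcK RRe_real; last first.
  by move/mxOverP: rA; apply.
by rewrite [_ * conjc _]mulrC -mulrA.
Qed.

Section Decomp.
Variables (T : finType) (rho : op R T) (p : T -> R) (u : T -> T -> C).
Hypothesis dec : spectral_decomp rho p u.

Lemma decomp_eigen x i : \sum_y rho x y * u y i = (p i)%:C%C * u x i.
Proof.
have [ou re] := dec.
under eq_bigr => y _ do rewrite re mulr_suml.
rewrite exchange_big /=.
transitivity (\sum_j (j == i)%:R * ((p j)%:C%C * u x j)); last exact: sum_delta.
apply: eq_bigr => j _; rewrite -ou mulr_suml; apply: eq_bigr => y _; ring.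
Qed.

Lemma decomp_eigenl y i : \sum_x conjc (u x i) * rho x y = (p i)%:C%C * conjc (u y i).
Proof.
have [ou re] := dec.
under eq_bigr => x _ do rewrite re mulr_sumr.
rewrite exchange_big /=.
transitivity (\sum_j (i == j)%:R * ((p j)%:C%C * conjc (u y j))); last exact: sum_deltal.
apply: eq_bigr => j _; rewrite -ou mulr_suml; apply: eq_bigr => x _; ring.
Qed.

Lemma decomp_hermitian : Defs.hermitian rho.
Proof.
have [ou re] := dec; move=> x y; rewrite !re conjc_sum; apply: eq_bigr => i _.
by rewrite !conjcM conjc_real conjcK; ring.
Qed.

Lemma decomp_form (v : T -> C) :
  \sum_x \sum_y conjc (v x) * rho x y * v y = (\sum_i p i * sqn (ip (u^~ i) v))%:C%C.
Proof.
have [ou re] := dec; rewrite real_complex_sum.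
transitivity (\sum_x \sum_y \sum_i (p i)%:C%C * ((conjc (v x) * u x i) * (conjc (u y i) * v y))).
  apply: eq_bigr => x _; apply: eq_bigr => y _; rewrite re mulr_sumr mulr_suml.
  apply: eq_bigr => i _; ring.
under eq_bigr => x _ do rewrite exchange_big /=.
rewrite exchange_big; apply: eq_bigr => i _ /=.
rewrite rmorphM /= -mulJc ipJ /ip mulr_suml mulr_sumr; apply: eq_bigr => x _.
by rewrite !mulr_sumr; apply: eq_bigr.
Qed.

Lemma decomp_trace : trace rho = (\sum_i p i)%:C%C.
Proof.
have [ou re] := dec; rewrite /trace real_complex_sum.
under eq_bigr => x _ do rewrite re.
rewrite exchange_big /=; apply: eq_bigr => i _.
transitivity ((p i)%:C%C * \sum_x conjc (u x i) * u x i); last first.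
  by rewrite ou eqxx mulr1.
by rewrite mulr_sumr; apply: eq_bigr => x _; ring.
Qed.

Lemma decomp_psd_ge0 i : psd rho -> 0 <= p i.
Proof.
move=> /(_ (u^~ i)); rewrite decomp_form ler0c.
rewrite (bigD1 i) //= big1 => [|j /negbTE ji].
  by rewrite addr0 /ip (proj1 dec) eqxx /sqn /= expr0n addr0 expr1n mulr1.
by rewrite /ip (proj1 dec) ji /sqn /= expr0n addr0 mulr0.
Qed.

Lemma decomp_psd : (forall i, 0 <= p i) -> psd rho.
Proof.
move=> p0 v; rewrite decomp_form ler0c sumr_ge0 // => i _.
by rewrite mulr_ge0 ?sqn_ge0.
Qed.

Lemma decomp_state : is_state rho <-> (forall i, 0 <= p i) /\ \sum_i p i = 1.
Proof.
split=> [[_ rho0 tr]|[p0 p1]].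
  split=> [i|]; first exact: decomp_psd_ge0.
  by apply: complexI; rewrite -decomp_trace.
split; [exact: decomp_hermitian|exact: decomp_psd|].
by rewrite decomp_trace p1.
Qed.

End Decomp.

(** Evaluate <v_j|rho|u_i> with rho acting to the right and to the left. *)
Lemma overlap_eigen (T : finType) (rho : op R T) p u q v i j :
  spectral_decomp rho p u -> spectral_decomp rho q v ->
  ip (v^~ j) (u^~ i) != 0 -> p i = q j.
Proof.
move=> dp dq; set c := ip _ _ => c0; apply: complexI; apply: (mulIf c0).
transitivity (\sum_x \sum_y conjc (v x j) * rho x y * u y i).
  rewrite mulr_sumr; apply: eq_bigr => x _ /=.
  under [RHS]eq_bigr => y _ do rewrite -mulrA.
  by rewrite -mulr_sumr (decomp_eigen dp); ring.
rewrite exchange_big mulr_sumr; apply: eq_bigr => y _ /=.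
by rewrite -mulr_suml (decomp_eigenl dq); ring.
Qed.

Lemma overlap_suml (T : finType) (u v : T -> T -> C) i :
  orthobasis u -> orthobasis v -> \sum_j sqn (ip (v^~ j) (u^~ i)) = 1.
Proof.
move=> ou ov; rewrite parseval //; apply: complexI; rewrite real_complex_sum.
under eq_bigr => x _ do rewrite -mulJc.
by rewrite ou eqxx.
Qed.

Lemma sqn_ipC (T : finType) (f g : T -> C) : sqn (ip f g) = sqn (ip g f).
Proof. by rewrite -ipJ sqnJ. Qed.

(** The weights |<v_j|u_i>|^2 are doubly stochastic and vanish unless p_i = q_j, so f(p_i) can be
    exchanged for f(q_j) under the double sum. Consequently the supremum in [vN] runs over a single
    value. *)
Lemma decomp_uniq (T : finType) (rho : op R T) p u q v (f : R -> R) :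
  spectral_decomp rho p u -> spectral_decomp rho q v ->
  \sum_i f (p i) = \sum_i f (q i).
Proof.
move=> dp dq.
transitivity (\sum_i \sum_j sqn (ip (v^~ j) (u^~ i)) * f (p i)).
  apply: eq_bigr => i _; rewrite -mulr_suml overlap_suml ?mul1r //.
    exact: (proj1 dp).
  exact: (proj1 dq).
transitivity (\sum_i \sum_j sqn (ip (v^~ j) (u^~ i)) * f (q j)).
  apply: eq_bigr => i _; apply: eq_bigr => j _.
  have [/eqP->|c0] := boolP (ip (v^~ j) (u^~ i) == 0).
    by rewrite /sqn /= expr0n addr0 !mul0r.
  by rewrite (overlap_eigen dp dq c0).
rewrite exchange_big; apply: eq_bigr => j _.
rewrite -mulr_suml; under eq_bigr => i _ do rewrite sqn_ipC.
rewrite overlap_suml ?mul1r //; [exact: (proj1 dq)|exact: (proj1 dp)].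
Qed.

Lemma shannon2E (T : finType) (p : T -> R) :
  shannon2 p = - (\sum_i p i * ln (p i)) / ln 2.
Proof.
rewrite /shannon2 mulNr mulr_suml; congr (- _); apply: eq_bigr => i _.
by case: eqP => [->|_]; rewrite ?mul0r ?mulrA.
Qed.

Lemma vN_decomp (T : finType) (rho : op R T) p u :
  spectral_decomp rho p u -> vN rho = shannon2 p.
Proof.
move=> dp; rewrite /vN -[RHS]sup1; congr sup; apply/seteqP; split=> s /=.
  case=> q [v [dq ->]].
  by rewrite !shannon2E (decomp_uniq (fun x => x * ln x) dq dp).
by move=> ->; exists p, u.
Qed.

End Spectral.

(** * Monotonicity of resolvent forms under partial trace *)

Section LogResolvent.
Variable R : realType.
Implicit Types x y t : R.

Lemma is_derive_bigsum (I : Type) (r : seq I) (F : I -> R -> R) (dF : I -> R) t :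
  (forall i, is_derive t 1 (F i) (dF i)) ->
  is_derive t 1 (fun s => \sum_(i <- r) F i s) (\sum_(i <- r) dF i).
Proof.
move=> dFE; elim: r => [|i r IH].
  under eq_fun do rewrite big_nil; rewrite big_nil; exact: is_derive_cst.
under eq_fun do rewrite big_cons; rewrite big_cons; exact: is_deriveD.
Qed.

Definition logsum (I : finType) (a x : I -> R) t := \sum_i a i * ln (x i + t).

Lemma is_derive_logsum (I : finType) (a x : I -> R) t :
  (forall i, 0 < x i + t) ->
  is_derive t 1 (logsum a x) (\sum_i a i / (x i + t)).
Proof.
move=> x0; apply: is_derive_bigsum => i.
have h : is_derive t 1 (fun s : R => x i + s) 1.
  have -> : (fun s : R => x i + s) = (cst (x i) \+ id) by [].
  rewrite -[X in is_derive _ _ _ X]add0r; exact: is_deriveD.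
have := is_derive1_comp (is_derive1_ln (x0 i)) h.
rewrite mulr1 => h2; exact: is_deriveZ.
Qed.

(* The difference H of the two sides, with t added to the arguments, is
   nondecreasing in t and tends to 0 at infinity. *)
Lemma logsum_le_pos (I J : finType) (a x : I -> R) (b y : J -> R) :
  (forall i, 0 <= a i) -> (forall j, 0 <= b j) ->
  (forall i, 0 < x i) -> (forall j, 0 < y j) ->
  \sum_i a i = \sum_j b j ->
  (forall t, 0 < t -> \sum_j b j / (y j + t) <= \sum_i a i / (x i + t)) ->
  \sum_i a i * ln (x i) <= \sum_j b j * ln (y j).
Proof.
move=> a0 b0 x0 y0 ab le_t.
pose H t := logsum a x t - logsum b y t.
pose dH t := \sum_i a i / (x i + t) - \sum_j b j / (y j + t).
have dHE t : 0 <= t -> is_derive t 1 H (dH t).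
  by move=> t0; apply: is_deriveB; apply: is_derive_logsum => i; rewrite ltr_wpDr.
have H0 t : 0 < t -> H 0 <= H t.
  move=> t0; have [||c] := @MVT R H dH 0 t t0.
  - by move=> z; rewrite in_itv /= => /andP[z0 _]; apply: dHE; exact: ltW.
  - apply: derivable_within_continuous => z; rewrite in_itv /= => /andP[z0 _].
    by have /@ex_derive := dHE _ z0.
  rewrite in_itv /= => /andP[c0 _] HE.
  by rewrite -subr_ge0 HE subr0 mulr_ge0 ?(ltW t0) // subr_ge0 le_t.
have ln_add (z t : R) : 0 < z -> 0 < t -> ln (z + t) = ln t + ln (1 + z / t).
  move=> z0 t0; rewrite -lnM ?posrE ?ltr_wpDr ?divr_ge0 ?ltW //.
  by congr ln; field; rewrite gt_eqF.
(* The equal total weights cancel the ln t terms; the rest is bounded by ln (1 + x/t) <= x/t and by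
   the sign of the subtracted sum. *)
have Ht t : 0 < t -> H t <= (\sum_i a i * x i) / t.
  move=> t0; rewrite /H /logsum.
  under eq_bigr => i _ do rewrite ln_add // mulrDr.
  under [X in _ - X <= _]eq_bigr => i _ do rewrite ln_add // mulrDr.
  rewrite !big_split /= -!mulr_suml ab opprD addrACA subrr add0r mulr_suml.
  apply: le_trans (_ : \sum_i a i * ln (1 + x i / t) <= _).
    rewrite gerBl sumr_ge0 // => j _; rewrite mulr_ge0 // ln_ge0 //.
    by rewrite lerDl divr_ge0 ?ltW.
  apply: ler_sum => i _; rewrite -mulrA ler_wpM2l // le_ln1Dx //.
  by rewrite (lt_le_trans (ltrN10 _)) // divr_ge0 ?ltW.
have : H 0 <= 0.
  have S0 : 0 <= \sum_i a i * x i by rewrite sumr_ge0 // => i _; rewrite mulr_ge0 // ltW.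
  rewrite leNgt; apply/negP => Hpos.
  (* At this t the bound H 0 <= S / t would give S + 1 <= S. *)
  set S := \sum_i _ in Ht S0; pose t := (S + 1) / H 0.
  have t0 : 0 < t by rewrite divr_gt0 // ltr_wpDl.
  have := le_trans (H0 _ t0) (Ht _ t0).
  rewrite ler_pdivlMr // /t mulrC divfK ?gt_eqF // gerDl.
  by rewrite leNgt ltr01.
rewrite /H /logsum subr_le0.
by under eq_bigr do rewrite addr0; under [X in _ <= X]eq_bigr do rewrite addr0.
Qed.

(** Arguments carrying weight zero may fail to be positive; replacing them by 1 changes neither the
    hypotheses nor the sums. *)
Lemma logsum_le (I J : finType) (a x : I -> R) (b y : J -> R) :
  (forall i, 0 <= a i) -> (forall j, 0 <= b j) ->
  (forall i, a i != 0 -> 0 < x i) -> (forall j, b j != 0 -> 0 < y j) ->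
  \sum_i a i = \sum_j b j ->
  (forall t, 0 < t -> \sum_j b j / (y j + t) <= \sum_i a i / (x i + t)) ->
  \sum_i a i * ln (x i) <= \sum_j b j * ln (y j).
Proof.
move=> a0 b0 x0 y0 ab le_t.
pose x' i := if a i == 0 then 1 else x i.
pose y' j := if b j == 0 then 1 else y j.
have ax (f : R -> R) i : a i * f (x i) = a i * f (x' i).
  by rewrite /x'; case: eqP => // ->; rewrite !mul0r.
have bx (f : R -> R) j : b j * f (y j) = b j * f (y' j).
  by rewrite /y'; case: eqP => // ->; rewrite !mul0r.
under eq_bigr do rewrite (ax (@ln R)).
under [X in _ <= X]eq_bigr do rewrite (bx (@ln R)).
apply: logsum_le_pos => // [i|j|t /le_t].
- by rewrite /x'; case: eqP => [_|/eqP/x0].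
- by rewrite /y'; case: eqP => [_|/eqP/y0].
under eq_bigr do rewrite (bx (fun y => (y + t)^-1)).
by under [X in _ <= X]eq_bigr do rewrite (ax (fun x => (x + t)^-1)).
Qed.

End LogResolvent.

(** * Resolvent sums as maxima of a quadratic functional *)

Section QuadraticForm.
Variable R : realType.
Local Notation C := R[i].

Lemma ip_basis (T : finType) (w : T -> T -> C) (f g : T -> C) : orthobasis w ->
  ip f g = \sum_i ip f (w^~ i) * ip (w^~ i) g.
Proof.
move=> ow.
transitivity (\sum_x \sum_y \sum_i (w x i * conjc (w y i)) * (conjc (f x) * g y)).
  apply: eq_bigr => x _.
  transitivity (\sum_y (x == y)%:R * (conjc (f x) * g y)).
    by rewrite sum_deltal.
  by apply: eq_bigr => y _; rewrite -mulr_suml orthobasis_complete.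
under eq_bigr => x _ do rewrite exchange_big /=.
rewrite exchange_big /=; apply: eq_bigr => i _.
rewrite /ip mulr_suml; apply: eq_bigr => x _; rewrite mulr_sumr.
by apply: eq_bigr => y _; ring.
Qed.

Lemma ip_sumr (T I : finType) (c : I -> C) (f : I -> T -> C) (g : T -> C) :
  ip g (fun x => \sum_i c i * f i x) = \sum_i c i * ip g (f i).
Proof.
rewrite /ip; under eq_bigr => x _ do rewrite mulr_sumr.
rewrite exchange_big; apply: eq_bigr => i _; rewrite mulr_sumr.
by apply: eq_bigr => x _; ring.
Qed.

Definition form (T : finType) (rho : op R T) (v : T -> C) : C :=
  \sum_x \sum_y conjc (v x) * rho x y * v y.

(* The Hilbert-Schmidt pairing tr(X^+ rho) and the forms tr(X^+ sigma X) and
   tr(X rho X^+), where X^+ is the adjoint of X. *)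
Definition hsip (T : finType) (X rho : op R T) : C :=
  \sum_x \sum_y conjc (X x y) * rho x y.
Definition quadl (T : finType) (sigma X : op R T) : C :=
  \sum_y form sigma (X^~ y).
Definition quadr (T : finType) (rho X : op R T) : C :=
  \sum_x form rho (fun y => conjc (X x y)).

Definition qfun (T : finType) (rho sigma : op R T) (t : R) (X : op R T) : R :=
  2 * Re (hsip X rho) - (Re (quadl sigma X) + t * Re (quadr rho X)).

Definition resolvent (T : finType) (p : T -> R) (u : T -> T -> C) (q : T -> R)
    (w : T -> T -> C) (t : R) : R :=
  \sum_i \sum_j (p j ^+ 2 * sqn (ip (w^~ i) (u^~ j))) / (q i + t * p j).

Section Coordinates.
Variables (T : finType) (rho sigma : op R T) (p q : T -> R) (u w : T -> T -> C).
Hypothesis dp : spectral_decomp rho p u.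
Hypothesis dq : spectral_decomp sigma q w.
Hypothesis p0 : forall i, 0 <= p i.
Hypothesis q0 : forall i, 0 <= q i.
Variable t : R.
Hypothesis t0 : 0 < t.

Let ou : orthobasis u := proj1 dp.
Let ow : orthobasis w := proj1 dq.

(** The matrix entry <w_i|X|u_j>. Since sigma acts on X from the left and rho from the right, this
    mixed basis diagonalises both forms at once, and [qfun] splits into one scalar quadratic for
    each pair (i, j). *)
Definition coord (X : op R T) i j : C :=
  ip (w^~ i) (fun x => \sum_y X x y * u y j).

Let row_ip (X : op R T) x j : ip (u^~ j) (fun y => conjc (X x y)) = conjc (\sum_y X x y * u y j).
Proof.
by rewrite /ip conjc_sum; apply: eq_bigr => y _; rewrite conjcM mulrC.
Qed.

Lemma quadlE X : quadl sigma X = (\sum_i \sum_j q i * sqn (coord X i j))%:C%C.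
Proof.
rewrite /quadl; under eq_bigr => y _ do rewrite /form (decomp_form dq).
rewrite -real_complex_sum exchange_big; congr (_%:C)%C; apply: eq_bigr => i _ /=.
rewrite -!mulr_sumr; congr (_ * _).
under eq_bigr => y _ do rewrite -sqnJ.
rewrite -(parseval _ ou); apply: eq_bigr => j _; rewrite -sqnJ; congr sqn.
rewrite /ip conjc_sum /coord /ip.
under eq_bigr => y _ do rewrite conjcM !conjcK mulr_sumr.
rewrite exchange_big; apply: eq_bigr => x _ /=.
by rewrite mulr_sumr; apply: eq_bigr => y _; ring.
Qed.

Lemma quadrE X : quadr rho X = (\sum_i \sum_j p j * sqn (coord X i j))%:C%C.
Proof.
rewrite /quadr; under eq_bigr => y _ do rewrite /form (decomp_form dp).
rewrite -real_complex_sum exchange_big [in RHS]exchange_big; congr (_%:C)%C.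
apply: eq_bigr => j _ /=; rewrite -!mulr_sumr; congr (_ * _).
by under eq_bigr => x _ do rewrite row_ip sqnJ; rewrite -(parseval _ ow).
Qed.

Lemma hsipE X : hsip X rho =
  \sum_i \sum_j (p j)%:C%C * (conjc (coord X i j) * ip (w^~ i) (u^~ j)).
Proof.
transitivity (\sum_j (p j)%:C%C * ip (fun x => \sum_y X x y * u y j) (u^~ j)).
  rewrite /hsip /ip; under [RHS]eq_bigr => j _ do rewrite mulr_sumr.
  rewrite [RHS]exchange_big; apply: eq_bigr => x _ /=.
  under [RHS]eq_bigr => j _ do rewrite conjc_sum mulr_suml mulr_sumr.
  rewrite [RHS]exchange_big; apply: eq_bigr => y _ /=.
  rewrite (proj2 dp) mulr_sumr; apply: eq_bigr => j _.
  by rewrite conjcM; ring.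
rewrite [RHS]exchange_big; apply: eq_bigr => j _ /=.
rewrite (ip_basis _ _ ow) mulr_sumr; apply: eq_bigr => i _.
by rewrite /coord ipJ.
Qed.

Lemma qfunE X : qfun rho sigma t X =
  \sum_i \sum_j (2 * p j * Re (conjc (coord X i j) * ip (w^~ i) (u^~ j))
                 - (q i + t * p j) * sqn (coord X i j)).
Proof.
rewrite /qfun quadlE quadrE !complexRe_real hsipE complexRe_sum !mulr_sumr -big_split -sumrB.
apply: eq_bigr => i _; rewrite complexRe_sum !mulr_sumr -big_split -sumrB.
by apply: eq_bigr => j _; rewrite complexRe_mulr /=; ring.
Qed.

(** Completing the square in each coordinate: the gap, multiplied by the denominator m = q_i + t
    p_j, is |p_j c - m x|^2. *)
Lemma qfun_le X : qfun rho sigma t X <= resolvent p u q w t.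
Proof.
rewrite qfunE; apply: ler_sum => i _; apply: ler_sum => j _.
set c := ip _ _; set x := coord X i j; set m := q i + _.
have m0 : 0 <= m by rewrite addr_ge0 // mulr_ge0 // ltW.
(* If the denominator vanishes then so does p_j, and both sides are 0 because division by 0 gives
   0. *)
have [mz|mN] := eqVneq m 0.
  have -> : p j = 0.
    move/eqP: mz; rewrite paddr_eq0 ?mulr_ge0 ?(ltW t0) // mulf_eq0 (gt_eqF t0) /=.
    by case/andP => _ /eqP.
  by rewrite mz invr0 !mulr0 !mul0r subr0.
rewrite ler_pdivlMr ?lt_neqAle ?m0 1?eq_sym ?mN // -subr_ge0.
have -> : p j ^+ 2 * sqn c - (2 * p j * Re (conjc x * c) - m * sqn x) * m
  = sqn ((p j)%:C%C * c - m%:C%C * x).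
  case: c => c1 c2; case: x => x1 x2; rewrite /sqn /=; ring.
exact: sqn_ge0.
Qed.

Lemma qfun_attained : exists X, qfun rho sigma t X = resolvent p u q w t.
Proof.
(* The coordinates at which the squares of [qfun_le] vanish; a zero denominator gives coordinate 0
   and a zero term on both sides. *)
pose x i j : C := ((p j / (q i + t * p j))%:C)%C * ip (w^~ i) (u^~ j).
exists (fun a b => \sum_i \sum_j x i j * (w a i * conjc (u b j))).
rewrite qfunE; apply: eq_bigr => i _; apply: eq_bigr => j _.
have -> : coord (fun a b => \sum_i \sum_j x i j * (w a i * conjc (u b j))) i j = x i j.
  rewrite /coord.
  have -> : (fun a => \sum_y (\sum_i \sum_j x i j * (w a i * conjc (u y j))) * u y j)
     = (fun a => \sum_i x i j * w a i).
    apply/funext => a; under eq_bigr => y _ do rewrite mulr_suml.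
    rewrite exchange_big; apply: eq_bigr => k _ /=.
    under eq_bigr => y _ do rewrite mulr_suml.
    rewrite exchange_big /=.
    transitivity (\sum_l (l == j)%:R * (x k l * w a k)).
      apply: eq_bigr => l _; rewrite -ou mulr_suml; apply: eq_bigr => y _; ring.
    by rewrite sum_delta.
  rewrite ip_sumr; transitivity (\sum_k (i == k)%:R * x k j); last by rewrite sum_deltal.
  by apply: eq_bigr => k _; rewrite -ow mulrC.
rewrite /x; set c := ip _ _; set m := q i + _.
have -> : Re (conjc (((p j / m)%:C)%C * c) * c) = p j / m * sqn c.
  by case: c => c1 c2; rewrite /sqn /=; ring.
rewrite sqnM sqn_real; have [->|m0] := eqVneq m 0.
  by rewrite invr0; ring.
by field.
Qed.

End Coordinates.

Definition extend (S E : finType) (X : op R S) : op R (prod S E) :=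
  fun x y => X x.1 y.1 * (x.2 == y.2)%:R.
Arguments extend {S} E X.

Lemma hsip_extend (S E : finType) (X : op R S) (rho : op R (prod S E)) :
  hsip (extend E X) rho = hsip X (trR rho).
Proof.
rewrite /hsip.
transitivity (\sum_s \sum_e \sum_s' \sum_e' (e == e')%:R * (conjc (X s s') * rho (s, e) (s', e'))).
  rewrite [RHS]pair_big; apply: eq_bigr => -[s e] _ /=; rewrite [RHS]pair_big.
  by apply: eq_bigr => -[s' e'] _; rewrite /extend /= conjcM conjc_nat; ring.
apply: eq_bigr => s _; rewrite exchange_big; apply: eq_bigr => s' _ /=.
by rewrite /trR mulr_sumr; apply: eq_bigr => e _; rewrite sum_deltal.
Qed.

Lemma quadl_extend (S E : finType) (X : op R S) (rho : op R (prod S E)) :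
  quadl rho (extend E X) = quadl (trR rho) X.
Proof.
rewrite /quadl /form.
transitivity (\sum_s \sum_e \sum_a \sum_d (d == e)%:R * \sum_b \sum_f (f == e)%:R *
   (conjc (X a s) * rho (a, d) (b, f) * X b s)).
  rewrite [RHS]pair_big; apply: eq_bigr => -[s e] _ /=; rewrite [RHS]pair_big.
  apply: eq_bigr => -[a d] _; rewrite /= [in RHS]pair_big mulr_sumr.
  by apply: eq_bigr => -[b f] _; rewrite /extend /= conjcM conjc_nat; ring.
apply: eq_bigr => s _; rewrite exchange_big; apply: eq_bigr => a _ /=.
under eq_bigr => e _ do rewrite sum_delta.
rewrite exchange_big; apply: eq_bigr => b _ /=.
rewrite /trR mulr_sumr mulr_suml; apply: eq_bigr => e _.
by rewrite sum_delta.
Qed.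

(** Passing to the adjoint of X turns [quadr] into [quadl] and commutes with [extend]. *)
Lemma quadr_extend (S E : finType) (X : op R S) (rho : op R (prod S E)) :
  quadr rho (extend E X) = quadr (trR rho) X.
Proof.
have -> (T : finType) (r Y : op R T) :
    quadr r Y = quadl r (fun y x => conjc (Y x y)) by [].
rewrite -[RHS]/(quadl (trR rho) (fun y x => conjc (X x y))) -quadl_extend.
congr quadl; apply/funext => y; apply/funext => x.
by rewrite /extend conjcM conjc_nat eq_sym.
Qed.

Lemma qfun_extend (S E : finType) (X : op R S) (rho sigma : op R (prod S E)) t :
  qfun rho sigma t (extend E X) = qfun (trR rho) (trR sigma) t X.
Proof. by rewrite /qfun hsip_extend quadl_extend quadr_extend. Qed.

Lemma resolvent_mono (S E : finType) (rho sigma : op R (prod S E)) p u q w p' u' q' w' t :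
  spectral_decomp rho p u -> spectral_decomp sigma q w ->
  spectral_decomp (trR rho) p' u' -> spectral_decomp (trR sigma) q' w' ->
  (forall i, 0 <= p i) -> (forall i, 0 <= q i) ->
  0 < t -> resolvent p' u' q' w' t <= resolvent p u q w t.
Proof.
move=> dp dq dp' dq' p0 q0 t0.
have [X <-] := qfun_attained dp' dq' t.
by rewrite -qfun_extend qfun_le.
Qed.

End QuadraticForm.

(** * Strong subadditivity *)

Section StrongSubadditivity.
Variable R : realType.
Local Notation C := R[i].

(** Relabelling of the basis along [f]. For bijective [f] it is a unitary change of coordinates;
    [assocr], [regroup] and the exchange of [trL] with [trR] are all instances up to conversion. *)
Definition rx (T T' : finType) (f : T' -> T) (rho : op R T) : op R T' :=
  fun x y => rho (f x) (f y).

Lemma decomp_rx (T T' : finType) (f : T' -> T) (rho : op R T) p u :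
  bijective f -> spectral_decomp rho p u ->
  spectral_decomp (rx f rho) (p \o f) (fun x i => u (f x) (f i)).
Proof.
move=> bf [ou re]; split=> [i j|x y].
  by rewrite -(inj_eq (bij_inj bf)) -ou [RHS](reindex f) //; exact: onW_bij.
by rewrite /rx re (reindex f) //; exact: onW_bij.
Qed.

Lemma state_decomp (T : finType) (rho : op R T) : is_state rho ->
  exists p u, [/\ spectral_decomp rho p u, forall i, 0 <= p i, \sum_i p i = 1 &
    vN rho = - (\sum_i p i * ln (p i)) / ln 2].
Proof.
move=> srho; have [hrho _ _] := srho.
have [p [u dp]] := spectral_exists hrho.
have [p0 p1] := (decomp_state dp).1 srho.
by exists p, u; split=> //; rewrite (vN_decomp dp) shannon2E.
Qed.

Lemma vN_rx (T T' : finType) (f : T' -> T) (rho : op R T) :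
  bijective f -> is_state rho -> vN (rx f rho) = vN rho.
Proof.
move=> bf srho; have [p [u [dp _ _ ->]]] := state_decomp srho.
rewrite (vN_decomp (decomp_rx bf dp)) shannon2E; congr (- _ / _).
by rewrite [RHS](reindex f) //; exact: onW_bij.
Qed.

Lemma state_rx (T T' : finType) (f : T' -> T) (rho : op R T) :
  bijective f -> is_state rho -> is_state (rx f rho).
Proof.
move=> bf srho; have [p [u [dp p0 p1 _]]] := state_decomp srho.
apply/(decomp_state (decomp_rx bf dp)); split=> [i|]; first exact: p0.
by rewrite -p1 [RHS](reindex f) //; exact: onW_bij.
Qed.

Lemma state_trR (T1 T2 : finType) (rho : op R (prod T1 T2)) :
  is_state rho -> is_state (trR rho).
Proof.
move=> [hrho prho trho]; split.
- by move=> x y; rewrite /trR conjc_sum; apply: eq_bigr => b _; exact: hrho.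
- move=> v.
  (* The form of the partial trace at v is the sum over b of the forms of [rho] at v (x) e_b. *)
  suff -> : \sum_x \sum_y conjc (v x) * trR rho x y * v y =
    \sum_b form rho (fun z => v z.1 * (z.2 == b)%:R).
    by apply: sumr_ge0 => b _; exact: prho.
  transitivity (\sum_b \sum_x \sum_y conjc (v x) * rho (x, b) (y, b) * v y).
    rewrite [RHS]exchange_big; apply: eq_bigr => x _ /=.
    rewrite [RHS]exchange_big; apply: eq_bigr => y _ /=.
    by rewrite /trR mulr_sumr mulr_suml.
  apply: eq_bigr => b _.
  transitivity (\sum_x \sum_c (c == b)%:R * \sum_y \sum_d (d == b)%:R *
     (conjc (v x) * rho (x, c) (y, d) * v y)).
    apply: eq_bigr => x _; rewrite sum_delta; apply: eq_bigr => y _.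
    by rewrite sum_delta.
  rewrite [LHS]pair_big; apply: eq_bigr => -[x c] _ /=.
  rewrite [in LHS]pair_big mulr_sumr; apply: eq_bigr => -[y d] _ /=.
  by rewrite conjcM conjc_nat; ring.
- by rewrite -trho /trace /trR pair_big; apply: eq_bigr => -[a b].
Qed.

Definition swapp (T1 T2 : Type) (x : T1 * T2) : T2 * T1 := (x.2, x.1).

Lemma swapp_bij (T1 T2 : Type) : bijective (@swapp T1 T2).
Proof. by exists (@swapp T2 T1); case. Qed.

Lemma state_trL (T1 T2 : finType) (rho : op R (prod T1 T2)) :
  is_state rho -> is_state (trL rho).
Proof.
move=> srho; apply: (@state_trR _ _ (rx (@swapp T2 T1) rho)).
by apply: state_rx => //; exact: swapp_bij.
Qed.

Definition assocp (T1 T2 T3 : Type) (x : T1 * (T2 * T3)) : (T1 * T2) * T3 :=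
  ((x.1, x.2.1), x.2.2).

Lemma assocp_bij (T1 T2 T3 : Type) : bijective (@assocp T1 T2 T3).
Proof. by exists (fun x => (x.1.1, (x.1.2, x.2))) => [[a [b c]]|[[a b] c]]. Qed.

Definition unassocp (T1 T2 T3 : Type) (x : (T1 * T2) * T3) : T1 * (T2 * T3) :=
  (x.1.1, (x.1.2, x.2)).

Lemma unassocp_bij (T1 T2 T3 : Type) : bijective (@unassocp T1 T2 T3).
Proof. by exists (@assocp T1 T2 T3) => [[[a b] c]|[a [b c]]]. Qed.

Definition relent (T : finType) (p : T -> R) (u : T -> T -> C) (q : T -> R)
    (w : T -> T -> C) : R :=
  \sum_i \sum_j (p j * sqn (ip (w^~ i) (u^~ j))) * ln (q i / p j).

(** The support of rho lies in that of sigma. Otherwise the relative entropy is infinite, whereas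
    [relent] would drop the offending terms, [ln] being 0 at 0. *)
Definition dominated (T : finType) (p : T -> R) (u : T -> T -> C) (q : T -> R)
    (w : T -> T -> C) : Prop :=
  forall i j, q i = 0 -> p j * sqn (ip (w^~ i) (u^~ j)) = 0.

Lemma relent_rx (T T' : finType) (f : T' -> T) p u q w : bijective f ->
  relent (p \o f) (fun x i => u (f x) (f i)) (q \o f) (fun x i => w (f x) (f i))
  = relent p u q w.
Proof.
move=> bf; rewrite /relent [RHS](reindex f); last exact: onW_bij.
apply: eq_bigr => i _; rewrite [RHS](reindex f); last exact: onW_bij.
apply: eq_bigr => j _; rewrite /ip [in RHS](reindex f) //; exact: onW_bij.
Qed.

Lemma dominated_rx (T T' : finType) (f : T' -> T) p u q w : bijective f ->
  dominated p u q w ->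
  dominated (p \o f) (fun x i => u (f x) (f i)) (q \o f) (fun x i => w (f x) (f i)).
Proof.
move=> bf dom i j /(dom _ (f j)); rewrite /ip [in X in X -> _](reindex f) //.
exact: onW_bij.
Qed.

(* [relent] is minus the relative entropy tr rho (ln rho - ln sigma). *)
Lemma relent_mono (S E : finType) (rho sigma : op R (prod S E)) p u q w p' u' q' w' :
  spectral_decomp rho p u -> spectral_decomp sigma q w ->
  spectral_decomp (trR rho) p' u' -> spectral_decomp (trR sigma) q' w' ->
  (forall i, 0 <= p i) -> (forall i, 0 <= q i) ->
  (forall i, 0 <= p' i) -> (forall i, 0 <= q' i) ->
  \sum_i p i = 1 -> \sum_i p' i = 1 ->
  dominated p u q w -> dominated p' u' q' w' ->
  relent p u q w <= relent p' u' q' w'.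
Proof.
move=> dp dq dp' dq' p0 q0 p0' q0' p1 p1' dom dom'.
(* The Nussbaum-Szkola distribution on pairs: weight p_j |<w_i|u_j>|^2 with likelihood ratio x = q_i
   / p_j. With it a / (x + t) is the resolvent term and a ln x the term of [relent], so [logsum_le]
   applies to classical sums. *)
pose a (T : finType) (p : T -> R) (u w : T -> T -> C) (k : T * T) :=
  p k.2 * sqn (ip (w^~ k.1) (u^~ k.2)) : R.
pose x (T : finType) (p q : T -> R) (k : T * T) := q k.1 / p k.2.
have a0 (T : finType) (P : T -> R) U W k : (forall i, 0 <= P i) -> 0 <= a T P U W k.
  by move=> P0; rewrite mulr_ge0 ?sqn_ge0.
have x0 (T : finType) (P Q : T -> R) U W k : (forall i, 0 <= P i) ->
    (forall i, 0 <= Q i) -> dominated P U Q W -> a T P U W k != 0 -> 0 < x T P Q k.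
  move=> P0 Q0 D aN0; rewrite /x divr_gt0 // lt_neqAle ?P0 ?Q0 andbT eq_sym.
    by apply: contra aN0 => /eqP/D E0; rewrite /a E0.
  by apply: contra aN0 => /eqP E0; rewrite /a E0 mul0r.
have asum (T : finType) (r s : op R T) P U Q W : spectral_decomp r P U ->
    spectral_decomp s Q W -> \sum_i P i = 1 -> \sum_k a T P U W k = 1.
  move=> dP dQ <-; rewrite -(pair_bigA _ (fun i j => P j * sqn (ip (W^~ i) (U^~ j)))) /=.
  rewrite exchange_big; apply: eq_bigr => j _ /=.
  by rewrite -mulr_sumr overlap_suml ?mulr1 //; [exact: (proj1 dP)|exact: (proj1 dQ)].
have resE (T : finType) (P Q : T -> R) U W t : 0 < t -> (forall i, 0 <= P i) ->
    (forall i, 0 <= Q i) ->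
    \sum_k a T P U W k / (x T P Q k + t) = resolvent P U Q W t.
  move=> t0 P0 Q0; rewrite /resolvent pair_big; apply: eq_bigr => -[i j] _.
  rewrite /a /x /=; have [->|PN] := eqVneq (P j) 0; first by rewrite expr0n /= !mul0r.
  have Pp : 0 < P j by rewrite lt_neqAle eq_sym PN P0.
  field; rewrite PN /= [t * _]mulrC gt_eqF //=.
    by rewrite ltr_wpDl ?mulr_gt0.
have relE (T : finType) (P Q : T -> R) U W :
    relent P U Q W = \sum_k a T P U W k * ln (x T P Q k).
  by rewrite /relent pair_big; apply: eq_bigr => -[i j].
rewrite !relE; apply: logsum_le => [k|k|k|k||t t0].
- exact: a0.
- exact: a0.
- exact: x0.
- exact: x0.
- by rewrite (asum _ _ _ _ _ _ _ dp dq) // (asum _ _ _ _ _ _ _ dp' dq').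
- rewrite !resE //; exact: (resolvent_mono dp dq dp' dq').
Qed.

(** The operator 1_A (x) tau, left unnormalised so that relative entropy against it is a conditional
    entropy. *)
Definition idl (A T : finType) (tau : op R T) : op R (prod A T) :=
  fun x y => (x.1 == y.1)%:R * tau x.2 y.2.

Lemma decomp_idl (A T : finType) (tau : op R T) s v : spectral_decomp tau s v ->
  spectral_decomp (@idl A T tau) (fun i => s i.2)
    (fun x i => (x.1 == i.1)%:R * v x.2 i.2).
Proof.
move=> [ov re]; split=> [[a i] [b j]|[a x] [b y]] /=.
  rewrite xpair_eqE -mulnb natrM -ov -(pair_bigA _ (fun c z => conjc ((c == a)%:R * v z i) *
    ((c == b)%:R * v z j))) /=.
  transitivity (\sum_c (c == a)%:R * ((c == b)%:R * \sum_z conjc (v z i) * v z j)).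
    apply: eq_bigr => c _; rewrite !mulr_sumr; apply: eq_bigr => z _.
    by rewrite conjcM conjc_nat; ring.
  by rewrite sum_delta.
rewrite /idl /= re mulr_sumr -(pair_bigA _ (fun c i => (s i)%:C%C * ((a == c)%:R * v x i) *
  conjc ((b == c)%:R * v y i))) /=.
transitivity (\sum_c (a == c)%:R * ((b == c)%:R * \sum_i ((s i)%:C%C * v x i * conjc (v y i)))).
  by rewrite sum_deltal eq_sym mulr_sumr.
apply: eq_bigr => c _; rewrite !mulr_sumr; apply: eq_bigr => i _.
by rewrite conjcM conjc_nat; ring.
Qed.

Lemma form_trL (A T : finType) (rho : op R (prod A T)) (v : T -> C) :
  \sum_a form rho (fun x => (x.1 == a)%:R * v x.2) = form (trL rho) v.
Proof.
transitivity (\sum_a \sum_x \sum_y conjc (v x) * rho (a, x) (a, y) * v y); last first.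
  rewrite [LHS]exchange_big; apply: eq_bigr => x _ /=.
  rewrite [LHS]exchange_big; apply: eq_bigr => y _ /=.
  by rewrite /trL mulr_sumr mulr_suml.
apply: eq_bigr => a _.
transitivity (\sum_b (b == a)%:R * \sum_x \sum_c (c == a)%:R * \sum_y
  conjc (v x) * rho (b, x) (c, y) * v y); last first.
  by rewrite sum_delta; apply: eq_bigr => x _; rewrite sum_delta.
rewrite /form; under [RHS]eq_bigr do rewrite mulr_sumr.
rewrite [RHS]pair_big; apply: eq_bigr => -[b x] _ /=.
under [in RHS]eq_bigr do rewrite mulr_sumr.
rewrite [in RHS]pair_big mulr_sumr; apply: eq_bigr => -[c y] _ /=.
by rewrite conjcM conjc_nat; ring.
Qed.

(** The value is S(AT) - S(T) in nats, the conditional entropy S(A|T); monotonicity of [relent] thus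
    says that conditioning on more lowers it. *)
Lemma relent_idl (A T : finType) (rho : op R (prod A T)) p u s v :
  spectral_decomp rho p u -> spectral_decomp (trL rho) s v ->
  (forall i, 0 <= p i) -> (forall i, 0 <= s i) ->
  let q := fun i : A * T => s i.2 in
  let w := fun x i : A * T => (x.1 == i.1)%:R * v x.2 i.2 in
  dominated p u q w /\
  relent p u q w = \sum_i s i * ln (s i) - \sum_i p i * ln (p i).
Proof.
move=> dp ds p0 s0 q w.
have dq : spectral_decomp (@idl A T (trL rho)) q w by exact: decomp_idl.
(* The diagonal entry <w_i|rho|w_i>. Its sum over the A-index is the eigenvalue s_k of the marginal,
   so s_k = 0 kills every nonnegative term in it: this is domination. *)
pose r i := \sum_j p j * sqn (ip (w^~ i) (u^~ j)).
have t0 i j : 0 <= p j * sqn (ip (w^~ i) (u^~ j)) by rewrite mulr_ge0 ?sqn_ge0.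
have r0 i : 0 <= r i by rewrite sumr_ge0.
have rs k : \sum_a r (a, k) = s k.
  apply: complexI; rewrite real_complex_sum.
  transitivity (\sum_a form rho (fun x => (x.1 == a)%:R * v x.2 k)).
    apply: eq_bigr => a _; rewrite /form (decomp_form dp); congr (_%:C)%C.
    by apply: eq_bigr => j _; rewrite sqn_ipC.
  rewrite (form_trL rho (v^~ k)) /form (decomp_form ds); congr (_%:C)%C.
  transitivity (\sum_i (i == k)%:R * s i); last exact: sum_delta.
  apply: eq_bigr => i _; rewrite /ip (proj1 ds) mulrC; congr (_ * _).
  by case: eqP; rewrite /sqn /= expr0n addr0 ?expr1n.
have dom : dominated p u q w.
  move=> [a k] j /= q0; apply/eqP; rewrite eq_le t0 andbT.
  have : r (a, k) <= 0.
    rewrite -[leRHS]q0 /q /= -(rs k) (bigD1 a) //= lerDl.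
    by rewrite sumr_ge0.
  by apply: le_trans; rewrite /r (bigD1 j) //= lerDl sumr_ge0.
split=> //.
transitivity (\sum_i \sum_j (p j * sqn (ip (w^~ i) (u^~ j)) * ln (q i) -
   p j * sqn (ip (w^~ i) (u^~ j)) * ln (p j))).
  apply: eq_bigr => i _; apply: eq_bigr => j _.
  have [->|pN] := eqVneq (p j) 0; first by rewrite !mul0r subr0.
  have [/(dom i j) ->|qN] := eqVneq (q i) 0; first by rewrite !mul0r subr0.
  have qi : 0 < q i by rewrite lt_neqAle eq_sym qN /q s0.
  have pj : 0 < p j by rewrite lt_neqAle eq_sym pN p0.
  by rewrite ln_div ?posrE // mulrBr.
under eq_bigr => i _ do rewrite sumrB.
rewrite sumrB; congr (_ - _).
  transitivity (\sum_i r i * ln (q i)).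
    by apply: eq_bigr => i _; rewrite mulr_suml.
  rewrite -(pair_bigA _ (fun a k => r (a, k) * ln (s k))) exchange_big.
  by apply: eq_bigr => k _; rewrite /= -mulr_suml rs.
rewrite exchange_big; apply: eq_bigr => j _ /=.
rewrite -mulr_suml; congr (_ * _); rewrite -mulr_sumr overlap_suml ?mulr1 //.
  exact: (proj1 dp).
exact: (proj1 dq).
Qed.

Lemma trR_trL_assocr (A B E : finType) (rho : op R (prod (prod A B) E)) :
  trR (trL (assocr rho)) = trL (trR rho).
Proof.
by apply/funext => x; apply/funext => y; rewrite /trR /trL exchange_big.
Qed.

Lemma ln2_gt0 : 0 < ln 2 :> R.
Proof. by rewrite ln_gt0 // ltr1n. Qed.

(** The conditioning system is the middle factor B: discarding E from the condition gives S(A|BE) <=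
    S(A|B). *)
Theorem strong_subadditivity (A B E : finType) (rho : op R (prod (prod A B) E)) :
  is_state rho ->
  vN rho + vN (trL (trR rho)) <= vN (trR rho) + vN (trL (assocr rho)).
Proof.
move=> srho.
have <- : vN (assocr rho) = vN rho by apply: vN_rx srho; exact: assocp_bij.
have sa : is_state (assocr rho) by apply: state_rx => //; exact: assocp_bij.
have [p [u [dp p0 p1 ->]]] := state_decomp sa.
have [p' [u' [dp' p0' p1' ->]]] := state_decomp (state_trR srho).
have [s [v [ds s0 s1 ->]]] := state_decomp (state_trL sa).
have [s' [v' [ds' s0' s1' ->]]] := state_decomp (state_trL (state_trR srho)).
have [dom rE] := relent_idl dp ds p0 s0.
have [dom' rE'] := relent_idl dp' ds' p0' s0'.
(* The reference operator 1_A (x) rho_BE is reassociated so that [trR] removes E and leaves 1_A (x)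
   rho_B. *)
have := @relent_mono _ _ rho (rx (@unassocp A B E) (@idl A _ (trL (assocr rho)))).
have bij := @unassocp_bij A B E.
have dp2 := decomp_rx bij dp.
have rhoE : rx (@unassocp A B E) (assocr rho) = rho.
  by apply/funext => -[[a b] c]; apply/funext => -[[a' b'] c'].
rewrite rhoE in dp2.
have dq' : spectral_decomp (trR (rx (@unassocp A B E) (@idl A _ (trL (assocr rho)))))
    (fun i => s' i.2) (fun x i => (x.1 == i.1)%:R * v' x.2 i.2).
  have -> : trR (rx (@unassocp A B E) (@idl A _ (trL (assocr rho)))) = @idl A _ (trL (trR rho)).
    rewrite -trR_trL_assocr; apply/funext => -[a b]; apply/funext => -[a' b'].
    by rewrite /trR /rx /idl /= mulr_sumr.
  exact: decomp_idl.
move=> /(_ _ _ _ _ _ _ _ _ dp2 (decomp_rx bij (decomp_idl A ds)) dp' dq').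
move=> H.
have {}H : \sum_i s i * ln (s i) - \sum_i p i * ln (p i) <=
           \sum_i s' i * ln (s' i) - \sum_i p' i * ln (p' i).
  rewrite -rE -rE' -(relent_rx _ _ _ _ bij); apply: H => //.
  - by move=> i; exact: p0.
  - by move=> i; exact: s0.
  - by rewrite -p1 [RHS](reindex (@unassocp A B E)) //; exact: onW_bij.
  - by apply: dominated_rx dom; exact: bij.
rewrite -!mulrDl ler_pM2r ?invr_gt0 ?ln2_gt0 //; lra.
Qed.

End StrongSubadditivity.

(** * Classical-quantum states and mixtures *)

Section FlaggedStates.
Variable R : realType.
Local Notation C := R[i].

Definition prob (K : finType) (p : K -> R) := (forall k, 0 <= p k) /\ \sum_k p k = 1.

Lemma xlnxM (x y : R) : 0 <= x -> 0 <= y ->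
  x * y * ln (x * y) = y * (x * ln x) + x * (y * ln y).
Proof.
rewrite !le_eqVlt => /predU1P[<-|x0]; first by rewrite !mul0r mulr0 addr0.
move=> /predU1P[<-|y0]; first by rewrite mulr0 !mul0r mulr0 addr0.
by rewrite lnM ?posrE //; ring.
Qed.

(** The flagged state has eigenvalues p_k times those of [sig k], with eigenvectors U_k (x) v_k. An
    arbitrary orthonormal [v] covers both classical flags, where it is the standard basis, and
    tensor products, where it is an eigenbasis of the second factor. *)
Lemma state_vN_flag (T K : finType) (p : K -> R) (v : K -> K -> C) (sig : K -> op R T)
    (omega : op R (prod T K)) : prob p -> orthobasis v ->
  (forall k, is_state (sig k)) ->
  (forall x y, omega x y =
     \sum_k (p k)%:C%C * sig k x.1 y.1 * (v x.2 k * conjc (v y.2 k))) ->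
  is_state omega /\ vN omega = shannon2 p + \sum_k p k * vN (sig k).
Proof.
move=> [p0 p1] ov ssig omegaE.
have [lU lUP] := choice (fun k => state_decomp (ssig k)).
have [U UP] := choice lUP.
pose q (i : T * K) := p i.2 * lU i.2 i.1.
pose w (x i : T * K) := U i.2 x.1 i.1 * v x.2 i.2.
have dw : spectral_decomp omega q w.
  split=> [[s k] [t l]|[x z] [y z']] /=.
    rewrite -(pair_bigA _ (fun x z => conjc (U k x s * v z k) * (U l x t * v z l))) /=.
    transitivity ((\sum_x conjc (U k x s) * U l x t) * (k == l)%:R).
      rewrite mulr_suml; apply: eq_bigr => x _; rewrite -ov mulr_sumr.
      by apply: eq_bigr => z _; rewrite conjcM; ring.
    rewrite xpair_eqE -mulnb natrM; case: eqP => [<-|_]; last by rewrite !mulr0.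
    by have [[-> _] _ _ _] := UP k.
  rewrite omegaE -(pair_bigA _ (fun t k => (p k * lU k t)%:C%C * (U k x t * v z k) *
    conjc (U k y t * v z' k))) exchange_big /=; apply: eq_bigr => k _.
  have [[_ ->] _ _ _] := UP k; rewrite mulr_sumr mulr_suml.
  by apply: eq_bigr => t _; rewrite conjcM rmorphM; ring.
have q0 i : 0 <= q i by have [_ l0 _ _] := UP i.2; rewrite mulr_ge0.
split.
  apply/(decomp_state dw); split=> //.
  rewrite -(pair_bigA _ (fun t k => p k * lU k t)) exchange_big /= -p1.
  apply: eq_bigr => k _; rewrite -mulr_sumr.
  by have [_ _ -> _] := UP k; rewrite mulr1.
rewrite (vN_decomp dw) !shannon2E.
have vs k : p k * vN (sig k) = - (p k * \sum_i lU k i * ln (lU k i)) / ln 2.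
  by have [_ _ _ ->] := UP k; rewrite mulrA mulrN.
rewrite (eq_bigr _ (fun k _ => vs k)).
rewrite -mulr_suml -mulrDl sumrN -opprD; congr (- _ / _).
rewrite -(pair_bigA _ (fun t k => p k * lU k t * ln (p k * lU k t))) exchange_big /=.
rewrite -big_split; apply: eq_bigr => k _ /=.
have [_ l0 l1 _] := UP k.
under eq_bigr => t _ do rewrite xlnxM //.
by rewrite big_split /= -mulr_suml l1 mul1r mulr_sumr.
Qed.

(** Convertible with [cq_state] when T is a product; the general T also covers the partial traces of
    such states. *)
Definition cq (T K : finType) (p : K -> R) (sig : K -> op R T) : op R (prod T K) :=
  fun x y => if x.2 == y.2 then (p x.2)%:C%C * sig x.2 x.1 y.1 else 0.

Lemma orthobasis_delta (K : finType) : orthobasis (fun x k : K => (x == k)%:R : C).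
Proof.
move=> i j; transitivity (\sum_x (x == i)%:R * (x == j)%:R : C).
  by apply: eq_bigr => x _; rewrite conjc_nat.
by rewrite sum_delta.
Qed.

Lemma state_vN_cq (T K : finType) (p : K -> R) (sig : K -> op R T) : prob p ->
  (forall k, is_state (sig k)) ->
  is_state (cq p sig) /\ vN (cq p sig) = shannon2 p + \sum_k p k * vN (sig k).
Proof.
move=> pp ssig; apply: (state_vN_flag pp (@orthobasis_delta K) ssig) => -[x k] [y l].
transitivity (\sum_j (k == j)%:R * ((l == j)%:R * ((p j)%:C%C * sig j x y))).
  by rewrite sum_deltal /cq /= eq_sym; case: eqP => _; rewrite ?mul1r ?mul0r.
by apply: eq_bigr => j _; rewrite conjc_nat /=; ring.
Qed.

Lemma state_cq (T K : finType) (p : K -> R) (sig : K -> op R T) : prob p ->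
  (forall k, is_state (sig k)) -> is_state (cq p sig).
Proof. by move=> pp ss; have [] := state_vN_cq pp ss. Qed.

Lemma vN_cq (T K : finType) (p : K -> R) (sig : K -> op R T) : prob p ->
  (forall k, is_state (sig k)) ->
  vN (cq p sig) = shannon2 p + \sum_k p k * vN (sig k).
Proof. by move=> pp ss; have [] := state_vN_cq pp ss. Qed.

Definition kron (S T : finType) (rho : op R S) (tau : op R T) : op R (prod S T) :=
  fun x y => rho x.1 y.1 * tau x.2 y.2.

Lemma state_vN_kron (S T : finType) (rho : op R S) (tau : op R T) :
  is_state rho -> is_state tau ->
  is_state (kron rho tau) /\ vN (kron rho tau) = vN rho + vN tau.
Proof.
move=> srho stau; have [p [v [dv p0 p1 _]]] := state_decomp stau.
rewrite (vN_decomp dv).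
have [|s ->] := @state_vN_flag S T p v (fun=> rho) (kron rho tau) (conj p0 p1)
  (proj1 dv) (fun=> srho).
  move=> x y; rewrite /kron (proj2 dv) mulr_sumr; apply: eq_bigr => k _; ring.
by split=> //; rewrite -mulr_suml p1 mul1r addrC.
Qed.

Lemma shannon2_delta (K : finType) (k : K) : shannon2 (fun i => (i == k)%:R : R) = 0.
Proof.
rewrite shannon2E big1 ?oppr0 ?mul0r // => i _.
by case: eqP => _; rewrite ?mul0r // ln1 mulr0.
Qed.

Lemma prob_delta (K : finType) (k : K) : prob (fun i => (i == k)%:R).
Proof.
split=> [i|]; first by rewrite ler0n.
rewrite -[RHS](sum_delta k (fun=> 1)); apply: eq_bigr => i _.
by rewrite mulr1.
Qed.

Lemma prob_le1 (K : finType) (p : K -> R) k : prob p -> p k <= 1.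
Proof.
by move=> [p0 p1]; rewrite -p1 (bigD1 k) //= lerDl sumr_ge0.
Qed.

Lemma shannon2_ge0 (K : finType) (p : K -> R) : prob p -> 0 <= shannon2 p.
Proof.
move=> pp; rewrite shannon2E -sumrN divr_ge0 ?(ltW (ln2_gt0 R)) // sumr_ge0 // => k _.
by rewrite oppr_ge0 mulr_ge0_le0 ?(proj1 pp) // ln_le0 // prob_le1.
Qed.

(** Each term satisfies p ln (1/p) <= 1, as ln x < x. The crude constant suffices because it does
    not depend on the number of copies. *)
Lemma shannon2_le (K : finType) (p : K -> R) : prob p -> shannon2 p <= #|K|%:R / ln 2.
Proof.
move=> [p0 p1]; rewrite shannon2E ler_pM2r ?invr_gt0 ?ln2_gt0 // -sumrN.
rewrite -sum1_card natr_sum; apply: ler_sum => k _.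
have := p0 k; rewrite le_eqVlt => /predU1P[<-|pk]; first by rewrite mul0r oppr0 ler01.
rewrite -mulrN -lnV ?posrE // -ler_pdivlMl // mulr1.
by rewrite ltW // ln_sublinear // invr_gt0.
Qed.

Lemma vN_ge0 (T : finType) (rho : op R T) : is_state rho -> 0 <= vN rho.
Proof.
move=> /state_decomp[p [u [dp p0 p1 _]]]; rewrite (vN_decomp dp).
exact: shannon2_ge0.
Qed.

Lemma vN_le (T : finType) (rho : op R T) : is_state rho -> vN rho <= #|T|%:R / ln 2.
Proof.
move=> /state_decomp[p [u [dp p0 p1 _]]]; rewrite (vN_decomp dp).
exact: shannon2_le.
Qed.

(** Strong subadditivity with a trivial middle system, whose entropy is nonnegative. *)
Lemma vN_subadd (A B : finType) (rho : op R (prod A B)) : is_state rho ->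
  vN rho <= vN (trR rho) + vN (trL rho).
Proof.
move=> srho.
pose f (x : (A * unit) * B) := (x.1.1, x.2).
have bf : bijective f by exists (fun x => ((x.1, tt), x.2)) => [[[a []] b]|[a b]].
have sf := state_rx bf srho.
have := strong_subadditivity sf; rewrite vN_rx //.
have -> : trR (rx f rho) = rx fst (trR rho) by [].
have -> : trL (assocr (rx f rho)) = rx snd (trL rho) by [].
rewrite vN_rx; [|by exists (fun x => (x, tt)) => [[x []]|x]|exact: state_trR].
rewrite vN_rx; [|by exists (fun x => (tt, x)) => [[[] x]|x]|exact: state_trL].
apply: le_trans; rewrite lerDl vN_ge0 //; apply: state_trL.
apply: state_rx; last exact: state_trR.
by exists (fun x => (x, tt)) => [[x []]|x].
Qed.

Definition mix (T K : finType) (p : K -> R) (sig : K -> op R T) : op R T :=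
  fun x y => \sum_k (p k)%:C%C * sig k x y.

Lemma trR_cq (T K : finType) (p : K -> R) (sig : K -> op R T) :
  trR (cq p sig) = mix p sig.
Proof.
by apply/funext => x; apply/funext => y; apply: eq_bigr => k _; rewrite /cq /= eqxx.
Qed.

Lemma state_mix (T K : finType) (p : K -> R) (sig : K -> op R T) : prob p ->
  (forall k, is_state (sig k)) -> is_state (mix p sig).
Proof. by move=> pp ss; rewrite -trR_cq; apply: state_trR; exact: state_cq. Qed.

Lemma vN_trL_cq (T K : finType) (p : K -> R) (sig : K -> op R T) : prob p ->
  (forall k, is_state (sig k)) -> vN (trL (cq p sig)) = shannon2 p.
Proof.
move=> pp ss; apply: (@vN_decomp _ _ _ p (fun x k => (x == k)%:R)); split.
  exact: orthobasis_delta.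
move=> k l; transitivity (\sum_j (k == j)%:R * ((l == j)%:R * (p j)%:C%C)); last first.
  by apply: eq_bigr => j _; rewrite conjc_nat; ring.
rewrite sum_deltal /trL /cq /= eq_sym; case: eqP => _; last by rewrite big1 // mul0r.
by have [_ _ t1] := ss k; rewrite -mulr_sumr mul1r -[X in _ * X]/(trace (sig k)) t1 mulr1.
Qed.

(** Concavity of the entropy, from subadditivity between the system and a classical flag: the
    entropy of the flag cancels. *)
Lemma vN_mix_ge (T K : finType) (p : K -> R) (sig : K -> op R T) : prob p ->
  (forall k, is_state (sig k)) -> \sum_k p k * vN (sig k) <= vN (mix p sig).
Proof.
move=> pp ss; have := vN_subadd (state_cq pp ss).
by rewrite trR_cq vN_cq // vN_trL_cq // addrC lerD2r.
Qed.

(* Strong subadditivity for the state sum_k p_k |k><k| (x) sig_k (x) |k><k|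
   with two copies of the classical flag. *)
Lemma vN_mix_le (T K : finType) (p : K -> R) (sig : K -> op R T) : prob p ->
  (forall k, is_state (sig k)) ->
  vN (mix p sig) <= shannon2 p + \sum_k p k * vN (sig k).
Proof.
move=> pp ss.
pose omega := cq p (fun k => cq (fun j => (j == k)%:R) (fun=> sig k)).
have sk k : is_state (cq (fun j => (j == k)%:R) (fun=> sig k)).
  by apply: state_cq => //; exact: prob_delta.
have so : is_state omega by apply: state_cq.
have vo : vN omega = shannon2 p + \sum_k p k * vN (sig k).
  rewrite vN_cq //; congr (_ + _); apply: eq_bigr => k _; congr (_ * _).
  rewrite vN_cq //; last exact: prob_delta.
  by rewrite shannon2_delta add0r sum_delta.
pose f (x : (K * T) * K) := ((x.1.2, x.1.1), x.2).
have bf : bijective f by exists (fun x => ((x.1.2, x.1.1), x.2)) => [[[x t] y]|[[t x] y]].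
have := strong_subadditivity (state_rx bf so); rewrite vN_rx // vo.
have -> : trR (rx f omega) = rx (@swapp K T) (cq p sig).
  apply/funext => -[k x]; apply/funext => -[l y].
  transitivity (\sum_j (k == j)%:R * ((k == l)%:R * ((p j)%:C%C * sig j x y))).
    apply: eq_bigr => j _; rewrite /rx /omega /cq /= eqxx.
    by do 2 case: eqP => _; rewrite ?mul0r ?mulr0 ?mul1r ?rmorph1 ?rmorph0 ?mul0r ?mulr0 ?mul1r.
  by rewrite sum_deltal /rx /cq /=; case: eqP; rewrite ?mul1r ?mul0r.
have -> : trL (assocr (rx f omega)) = cq p sig.
  apply/funext => -[x k]; apply/funext => -[y l].
  transitivity (\sum_j (j == k)%:R * ((k == l)%:R * ((p k)%:C%C * sig k x y))).
    apply: eq_bigr => j _; rewrite /assocr /rx /omega /cq /= eqxx.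
    by do 2 case: eqP => _; rewrite ?mul0r ?mulr0 ?mul1r ?rmorph1 ?rmorph0 ?mul0r ?mulr0 ?mul1r.
  by rewrite sum_delta /cq /=; case: eqP; rewrite ?mul1r ?mul0r.
have -> : trL (rx (@swapp K T) (cq p sig)) = mix p sig by rewrite -trR_cq.
rewrite vN_rx; [|exact: swapp_bij|exact: state_cq].
by rewrite vN_cq //; lra.
Qed.

Lemma MI_ge0 (A B : finType) (rho : op R (prod A B)) : is_state rho -> 0 <= MI rho.
Proof. by move=> /vN_subadd; rewrite /MI subr_ge0. Qed.

Lemma MI_le (A B : finType) (rho : op R (prod A B)) : is_state rho ->
  MI rho <= (#|A| + #|B|)%:R / ln 2.
Proof.
move=> srho; rewrite /MI natrD mulrDl.
have := vN_le (state_trR srho); have := vN_le (state_trL srho).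
by have := vN_ge0 srho; lra.
Qed.

Lemma trR_mix (A B K : finType) (p : K -> R) (sig : K -> op R (prod A B)) :
  trR (mix p sig) = mix p (fun k => trR (sig k)).
Proof.
apply/funext => x; apply/funext => y; rewrite /trR /mix exchange_big.
by apply: eq_bigr => k _; rewrite mulr_sumr.
Qed.

Lemma trL_mix (A B K : finType) (p : K -> R) (sig : K -> op R (prod A B)) :
  trL (mix p sig) = mix p (fun k => trL (sig k)).
Proof.
apply/funext => x; apply/funext => y; rewrite /trL /mix exchange_big.
by apply: eq_bigr => k _; rewrite mulr_sumr.
Qed.

Lemma sum_MI (A B K : finType) (p : K -> R) (sig : K -> op R (prod A B)) :
  \sum_k p k * MI (sig k) = \sum_k p k * vN (trR (sig k)) +
   \sum_k p k * vN (trL (sig k)) - \sum_k p k * vN (sig k).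
Proof.
by rewrite -big_split -sumrB; apply: eq_bigr => k _; rewrite /MI mulrBr mulrDr.
Qed.

(** Each of the two marginal entropies exceeds its average by at most the entropy of [p], and the
    joint entropy is not below its average; hence the factor 2. *)
Lemma MI_mix_le (A B K : finType) (p : K -> R) (sig : K -> op R (prod A B)) :
  prob p -> (forall k, is_state (sig k)) ->
  MI (mix p sig) <= \sum_k p k * MI (sig k) + 2 * shannon2 p.
Proof.
move=> pp ss; rewrite sum_MI {1}/MI trR_mix trL_mix.
have := vN_mix_ge pp ss.
have := vN_mix_le pp (fun k => state_trR (ss k)).
have := vN_mix_le pp (fun k => state_trL (ss k)); lra.
Qed.

(** The entropy of the flag occurs in S(AK), S(BK), S(ABK) and S(K) and cancels, leaving the average
    of the conditional states. *)
Lemma sq_obj_cq (A B K : finType) (p : K -> R) (sig : K -> op R (prod A B)) :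
  prob p -> (forall k, is_state (sig k)) ->
  sq_obj (cq_state p sig) = \sum_k p k * MI (sig k).
Proof.
move=> pp ss.
have scq : is_state (cq_state p sig) by exact: (state_cq pp ss).
have smid : trmid (cq_state p sig) = cq p (fun k => trR (sig k)).
  apply/funext => -[a k]; apply/funext => -[a' k'].
  rewrite /trmid /cq_state /cq /=; case: eqP => _; last by rewrite big1.
  by rewrite -mulr_sumr.
have sBE : trL (assocr (cq_state p sig)) = cq p (fun k => trL (sig k)).
  apply/funext => -[a k]; apply/funext => -[a' k'].
  rewrite /trL /assocr /cq_state /cq /=; case: eqP => _; last by rewrite big1.
  by rewrite -mulr_sumr.
have sA : trR (assocr (cq_state p sig)) = trR (trmid (cq_state p sig)).
  apply/funext => a; apply/funext => a'.
  by rewrite /trR /trmid exchange_big pair_bigA; apply: eq_bigr => -[].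
have sR k : is_state (trR (sig k)) by exact: state_trR.
have sL k : is_state (trL (sig k)) by exact: state_trL.
rewrite /sq_obj /MI sA sBE smid vN_trL_cq // !vN_cq // sum_MI.
rewrite [vN (assocr _)](vN_rx (@assocp_bij A B K)) //.
rewrite [vN (cq_state _ _)]vN_cq //; lra.
Qed.

End FlaggedStates.

(** * Conditional mutual information; Fekete's lemma *)

Section ConditionalMI.
Variable R : realType.
Local Notation C := R[i].

Lemma trR_assocr (A B E : finType) (rho : op R (prod (prod A B) E)) :
  trR (assocr rho) = trR (trmid rho).
Proof.
apply/funext => a; apply/funext => a'.
by rewrite /trR /trmid exchange_big pair_bigA; apply: eq_bigr => -[].
Qed.

Lemma state_assocr (A B E : finType) (rho : op R (prod (prod A B) E)) :
  is_state rho -> is_state (assocr rho).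
Proof. by move=> sr; apply: (state_rx (@assocp_bij A B E)). Qed.

Lemma vN_assocr (A B E : finType) (rho : op R (prod (prod A B) E)) :
  is_state rho -> vN (assocr rho) = vN rho.
Proof. by move=> sr; apply: (vN_rx (@assocp_bij A B E)). Qed.

Definition swap_mid (A B E : Type) (x : (A * E) * B) : (A * B) * E :=
  ((x.1.1, x.2), x.1.2).

Lemma swap_mid_bij (A B E : Type) : bijective (@swap_mid A B E).
Proof. by exists (@swap_mid A E B) => [[[a e] b]|[[a b] e]]. Qed.

Lemma trmid_rx (A B E : finType) (rho : op R (prod (prod A B) E)) :
  trmid rho = trR (rx (@swap_mid A B E) rho).
Proof. by []. Qed.

(** S(A) cancels, and the objective becomes the conditional mutual information I(A:B|E). *)
Lemma sq_objE (A B E : finType) (rho : op R (prod (prod A B) E)) :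
  is_state rho -> sq_obj rho = vN (trL (assocr rho)) + vN (trmid rho)
     - vN rho - vN (trL (trmid rho)).
Proof. by move=> sr; rewrite /sq_obj /MI trR_assocr vN_assocr //; ring. Qed.

Lemma sq_obj_ge0 (A B E : finType) (rho : op R (prod (prod A B) E)) :
  is_state rho -> 0 <= sq_obj rho.
Proof.
move=> sr; rewrite sq_objE //.
have bs := @swap_mid_bij A B E.
have := strong_subadditivity (state_rx bs sr).
rewrite vN_rx // -trmid_rx.
have -> : trL (assocr (rx (@swap_mid A B E) rho)) = rx (@swapp E B) (trL (assocr rho)) by [].
rewrite vN_rx; [lra|exact: swapp_bij|apply: state_trL; exact: state_assocr].
Qed.

Lemma sq_obj_le_EI_obj (A B A' B' : finType)
    (rho : op R (prod (prod A B) (prod A' B'))) :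
  is_state rho -> sq_obj rho <= EI_obj rho.
Proof.
move=> sr; rewrite sq_objE // /EI_obj /MI.
have smid : is_state (trmid rho).
  by rewrite trmid_rx; apply/state_trR/state_rx => //; exact: swap_mid_bij.
have sBE : is_state (trL (assocr rho)) by apply/state_trL/state_assocr.
have -> : vN (regroup rho) = vN rho.
  apply: (@vN_rx _ _ _ (fun x : (A * A') * (B * B') => ((x.1.1, x.2.1), (x.1.2, x.2.2)))) => //.
  by exists (fun x => ((x.1.1, x.2.1), (x.1.2, x.2.2))) => [[[a a'] [b b']]|[[a b] [a' b']]].
(* The two regroupings put A', respectively B', in the middle, so that strong subadditivity yields
   I(A:B'|A') >= 0 and I(B:A'|B') >= 0. *)
have b1 := @unassocp_bij A A' B'.
have b2 : bijective (fun x : (B * B') * A' => (x.1.1, (x.2, x.1.2))).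
  by exists (fun x => ((x.1, x.2.2), x.2.1)) => [[[b b'] a']|[b [a' b']]].
have := strong_subadditivity (state_rx b1 smid).
have := strong_subadditivity (state_rx b2 sBE).
rewrite vN_rx // [vN (rx _ (trmid _))]vN_rx //.
set X := vN (trR (regroup rho)); set Y := vN (trL (regroup rho)).
set Z := vN (trL (trmid rho)); set W := vN (trL rho).
set U := vN (trR (trL rho)); set V := vN (trL (trL rho)).
have E1 : trR (rx (@unassocp A A' B') (trmid rho)) = trR (regroup rho).
  apply/funext => -[a a']; apply/funext => -[c c'].
  by rewrite /trR /rx /trmid /regroup /= exchange_big pair_bigA; apply: eq_bigr => -[].
have E2 : trL (assocr (rx (@unassocp A A' B') (trmid rho))) = trL rho.
  apply/funext => -[a b]; apply/funext => -[c c'].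
  by rewrite /trL /rx /trmid /assocr /= pair_bigA; apply: eq_bigr => -[].
have E2' : trL (trmid rho) = trL rho.
  by rewrite -E2; apply/funext => -[a b]; apply/funext => -[c d].
have E3 : trL (trR (rx (@unassocp A A' B') (trmid rho))) = trR (trL rho).
  by rewrite -trR_trL_assocr E2.
pose f2 := fun x : (B * B') * A' => (x.1.1, (x.2, x.1.2)).
have F1 : trR (rx f2 (trL (assocr rho))) = trL (regroup rho).
  apply/funext => -[b b']; apply/funext => -[c c'].
  by rewrite /trR /trL /rx /assocr /regroup /= exchange_big pair_bigA; apply: eq_bigr => -[].
have F2 : trL (assocr (rx f2 (trL (assocr rho)))) = rx (@swapp B' A') (trL rho).
  apply/funext => -[b a]; apply/funext => -[d c].
  by rewrite /trL /rx /assocr /= exchange_big pair_bigA; apply: eq_bigr => -[].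
have F3 : trL (trR (rx f2 (trL (assocr rho)))) = trL (trL rho).
  by rewrite -trR_trL_assocr F2.
rewrite F3 F1 F2 E3 E1 E2 /Z E2' -/W.
rewrite vN_rx; [rewrite -/X -/Y -/W -/U -/V; lra|exact: swapp_bij|exact: state_trL].
Qed.

End ConditionalMI.

(** * Subadditive sequences and sublinear errors *)

Section Fekete.
Variable R : realType.
Local Open Scope classical_set_scope.

(** Writing n = q m + r bounds a n by q a m plus a constant depending on m alone, so the limit is
    the infimum of a m / m over m > 0. *)
Lemma fekete (a : nat -> R) : (forall n, 0 <= a n) ->
  (forall m n, a (m + n)%N <= a m + a n) ->
  cvgn (fun n => a n / n%:R) /\
  (forall m, (0 < m)%N -> limn (fun n => a n / n%:R) <= a m / m%:R).
Proof.
move=> a0 sub.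
pose S := [set x | exists2 m, (0 < m)%N & x = a m / m%:R].
have lbS : lbound S 0 by move=> _ [m _ ->]; rewrite divr_ge0.
have infS : has_inf S by split; [exists (a 1%N / 1%:R), 1%N|exists 0].
pose L := inf S.
have L_le m : (0 < m)%N -> L <= a m / m%:R.
  by move=> m0; apply: ge_inf; [exists 0|exists m].
have amul q m : a (q * m)%N <= q%:R * a m + a 0%N.
  elim: q => [|q IH]; first by rewrite mul0n mul0r add0r.
  by rewrite mulSn (le_trans (sub _ _)) // -natr1 mulrDl mul1r [_ + a m]addrC -addrA lerD2l.
have cvgL : (fun n => a n / n%:R) @ \oo --> L.
  apply/cvgrPdist_lt => e e0.
  have e2 : 0 < e / 2 by rewrite divr_gt0.
  have [_ [m m0 ->] am] := inf_adherent e2 infS.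
  (* Dominates every remainder a r with r < m, together with the a 0 left by the induction in
     [amul], which starts at q = 0. *)
  pose M := \sum_(i < m) a i + a 0%N.
  have M0 : 0 <= M by rewrite addr_ge0 // sumr_ge0.
  have m0R : 0 < m%:R :> R by rewrite ltr0n.
  near=> n.
  have n0 : (0 < n)%N by near: n; exact: nbhs_infty_gt.
  have n0R : 0 < n%:R :> R by rewrite ltr0n.
  have nM : M / (e / 2) < n%:R by near: n; exact: nbhs_infty_gtr.
  have up : a n <= n%:R * (a m / m%:R) + M.
    rewrite {1}(divn_eq n m) (le_trans (sub _ _)) //.
    apply: (@le_trans _ _ ((n %/ m)%:R * a m + a 0%N + \sum_(i < m) a i)).
      rewrite lerD // (bigD1 (Ordinal (ltn_pmod n m0))) //= lerDl.
      by rewrite sumr_ge0.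
    rewrite /M -addrA [a 0%N + _]addrC lerD2r mulrCA [X in _ <= X]mulrC ler_wpM2r //.
    by rewrite ler_pdivlMr // -natrM ler_nat leq_divM.
  rewrite ltr_distlC; apply/andP; split.
    by rewrite (lt_le_trans _ (L_le _ n0)) // ltrBlDr ltrDl.
  rewrite ltr_pdivrMr // (le_lt_trans up) //.
  apply: (@lt_trans _ _ (n%:R * (L + e / 2) + M)).
    by rewrite ltrD2r ltr_pM2l.
  rewrite [X in _ < X]mulrC -ltrBrDl -mulrBr opprD addrACA subrr add0r.
  have -> : e - e / 2 = e / 2 by field.
  by rewrite -ltr_pdivrMr.
split; first by apply/cvg_ex; exists L.
by move=> m m0; rewrite (cvg_lim _ cvgL) ?L_le.
Unshelve. all: by end_near.
Qed.

Lemma sublinear_bound (x : R) (c d : R) : 0 <= d ->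
  (forall n : nat, (0 < n)%N -> x <= (c + d * ln n%:R) / n%:R) -> x <= 0.
Proof.
move=> d0 H; rewrite leNgt; apply/negP => x0.
pose K := `|c| + 2 * d.
have K0 : 0 <= K by rewrite addr_ge0 ?mulr_ge0.
have := archi_boundP (divr_ge0 K0 (ltW x0)).
set N := Num.bound _; rewrite ltr_pdivrMr // => KN.
have N0 : (0 < N)%N by rewrite -(ltr0n R) -(pmulr_lgt0 _ x0); exact: le_lt_trans KN.
have N0R : 0 < N%:R :> R by rewrite ltr0n.
have N1 : 1 <= N%:R :> R by rewrite ler1n.
(* At n = N^2 the logarithm is 2 ln N <= 2 N, so the numerator is at most K N, which is below x N^2
   by the choice of N. *)
have := H (N * N)%N; rewrite muln_gt0 N0 => /(_ isT).
rewrite natrM ler_pdivlMr ?mulr_gt0 // lnM ?posrE // leNgt => /negP; apply.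
have lnN := ltW (ln_sublinear N0R).
apply: (@le_lt_trans _ _ (K * N%:R)).
  rewrite mulrDl lerD //.
    by rewrite (le_trans (ler_norm _)) // ler_peMr.
  by rewrite [2 * d]mulrC -mulrA ler_wpM2l // mulrDl !mul1r lerD.
by rewrite mulrA ltr_pM2r // mulrC.
Qed.

End Fekete.

(** * Product states *)

Section Products.
Variable R : realType.
Local Notation C := R[i].

Lemma ln_prod_pos (I : finType) (x : I -> R) : (forall i, 0 < x i) ->
  0 < \prod_i x i /\ ln (\prod_i x i) = \sum_i ln (x i).
Proof.
move=> x0; apply: (big_rec2 (fun a b => 0 < a /\ ln a = b)).
  by rewrite ln1.
by move=> i a _ _ [b0 <-]; rewrite mulr_gt0 // lnM ?posrE.
Qed.

Lemma xlnx_prod (I : finType) (x : I -> R) : (forall i, 0 <= x i) ->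
  (\prod_i x i) * ln (\prod_i x i) = \sum_i (\prod_j x j) * ln (x i).
Proof.
move=> x0; rewrite -mulr_sumr.
have [/existsP[i /eqP xi]|/existsPn xN] := boolP [exists i, x i == 0].
  by rewrite (bigD1 i) //= xi !mul0r.
have [|_ -> //] := @ln_prod_pos _ x.
by move=> i; rewrite lt_neqAle eq_sym xN x0.
Qed.

Definition prodT (I T : finType) (tau : I -> op R T) : op R {ffun I -> T} :=
  fun x y => \prod_i tau i (x i) (y i).

Lemma prod_delta (I T : finType) (f g : {ffun I -> T}) :
  \prod_i (f i == g i)%:R = (f == g)%:R :> C.
Proof.
have [->|fg] := eqVneq f g; first by rewrite big1 // => i _; rewrite eqxx.
have [i /negbTE fgi] : exists i, f i != g i.
  apply/existsP; apply: contraR fg; rewrite negb_exists => /forallP fg.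
  by apply/eqP/ffunP => i; have := fg i; rewrite negbK => /eqP.
by rewrite (bigD1 i) //= fgi mul0r.
Qed.

Lemma conjc_prod (I : Type) (r : seq I) (F : I -> C) :
  conjc (\prod_(i <- r) F i) = \prod_(i <- r) conjc (F i).
Proof. exact: rmorph_prod. Qed.

Lemma state_vN_prodT (I T : finType) (tau : I -> op R T) :
  (forall i, is_state (tau i)) ->
  is_state (prodT tau) /\ vN (prodT tau) = \sum_i vN (tau i).
Proof.
move=> st.
have [p pP] := choice (fun i => state_decomp (st i)).
have [U UP] := choice pP.
pose P (f : {ffun I -> T}) := \prod_i p i (f i).
pose W (x f : {ffun I -> T}) := \prod_i U i (x i) (f i).
have p0 i a : 0 <= p i a by have [_ p0 _ _] := UP i.
have p1 i : \sum_a p i a = 1 by have [_ _ p1 _] := UP i.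
have dW : spectral_decomp (prodT tau) P W.
  split=> [f g|x y].
    rewrite -prod_delta.
    transitivity (\prod_i \sum_a conjc (U i a (f i)) * U i a (g i)).
      rewrite bigA_distr_bigA /=; apply: eq_bigr => x _.
      by rewrite conjc_prod -big_split.
    by apply: eq_bigr => i _; have [[-> _] _ _ _] := UP i.
  transitivity (\prod_i \sum_a (p i a)%:C%C * U i (x i) a * conjc (U i (y i) a)).
    by apply: eq_bigr => i _; have [[_ ->] _ _ _] := UP i.
  rewrite bigA_distr_bigA /=; apply: eq_bigr => f _.
  by rewrite conjc_prod rmorph_prod -!big_split.
split.
  apply/(decomp_state dW); split=> [f|]; first by rewrite prodr_ge0.
  by rewrite -bigA_distr_bigA big1.
rewrite (vN_decomp dW) shannon2E.
have vs i : vN (tau i) = - (\sum_a p i a * ln (p i a)) / ln 2.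
  by have [_ _ _ ->] := UP i.
rewrite (eq_bigr _ (fun i _ => vs i)) -mulr_suml sumrN; congr (- _ / _).
under eq_bigr => f _ do rewrite xlnx_prod //.
rewrite exchange_big; apply: eq_bigr => i _ /=.
(* Only the i-th factor carries the logarithm, so the sum over functions factorises and all other
   factors sum to 1. *)
pose F j a := if j == i then p j a * ln (p j a) else p j a.
transitivity (\sum_(f : {ffun I -> T}) \prod_j F j (f j)).
  apply: eq_bigr => f _; rewrite (bigD1 i) // [RHS](bigD1 i) //= /F eqxx.
  by rewrite mulrAC; congr (_ * _); apply: eq_bigr => j ji; rewrite (negbTE ji).
rewrite -bigA_distr_bigA (bigD1 i) //= [X in _ * X]big1 ?mulr1 => [|j ji].
  by apply: eq_bigr => a _; rewrite /F eqxx.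
by rewrite -(p1 j); apply: eq_bigr => a _; rewrite /F (negbTE ji).
Qed.

(** The product state cut between all A-systems and all B-systems; a constant family gives
    [tpow]. *)
Definition prodop (A B I : finType) (tau : I -> op R (prod A B)) :
    op R (prod {ffun I -> A} {ffun I -> B}) :=
  fun x y => \prod_i tau i (x.1 i, x.2 i) (y.1 i, y.2 i).

Definition zipf (A B I : finType) (x : {ffun I -> A} * {ffun I -> B}) :
  {ffun I -> A * B} := [ffun i => (x.1 i, x.2 i)].

Lemma zipf_bij (A B I : finType) : bijective (@zipf A B I).
Proof.
exists (fun f : {ffun I -> A * B} => ([ffun i => (f i).1], [ffun i => (f i).2])) => [[f g]|f].
  by congr (_, _); apply/ffunP => i; rewrite !ffunE.
by apply/ffunP => i; rewrite !ffunE /=; case: (f i).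
Qed.

Lemma prodopE (A B I : finType) (tau : I -> op R (prod A B)) :
  prodop tau = rx (@zipf A B I) (prodT tau).
Proof.
apply/funext => x; apply/funext => y.
by apply: eq_bigr => i _; rewrite !ffunE.
Qed.

Lemma trR_prodop (A B I : finType) (tau : I -> op R (prod A B)) :
  trR (prodop tau) = prodT (fun i => trR (tau i)).
Proof.
by apply/funext => x; apply/funext => y; rewrite /prodT bigA_distr_bigA.
Qed.

Lemma trL_prodop (A B I : finType) (tau : I -> op R (prod A B)) :
  trL (prodop tau) = prodT (fun i => trL (tau i)).
Proof.
by apply/funext => x; apply/funext => y; rewrite /prodT bigA_distr_bigA.
Qed.

Lemma state_prodop (A B I : finType) (tau : I -> op R (prod A B)) :
  (forall i, is_state (tau i)) -> is_state (prodop tau).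
Proof.
by move=> st; rewrite prodopE; apply: state_rx (proj1 (state_vN_prodT st)); exact: zipf_bij.
Qed.

Lemma MI_prodop (A B I : finType) (tau : I -> op R (prod A B)) :
  (forall i, is_state (tau i)) -> MI (prodop tau) = \sum_i MI (tau i).
Proof.
move=> st; have [sp vp] := state_vN_prodT st.
have [_ vR] := state_vN_prodT (fun i => state_trR (st i)).
have [_ vL] := state_vN_prodT (fun i => state_trL (st i)).
rewrite /MI trR_prodop trL_prodop vR vL prodopE vN_rx //; last exact: zipf_bij.
by rewrite vp sumrB big_split.
Qed.

Lemma marg_prodop (A B : finType) n (tau : 'I_n -> op R (prod A B)) k :
  (forall i, is_state (tau i)) -> marg (prodop tau) k = tau k.
Proof.
move=> st; apply/funext => -[a b]; apply/funext => -[a' b'].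
(* The i-th factor after the update at k: a fixed entry of [tau k] at k, a diagonal entry elsewhere.
   Distributing the sums then produces a trace, equal to 1, at every other position. *)
pose G i c d : C := if i == k then tau k (a, b) (a', b') else tau i (c, d) (c, d).
pose Q i (a c : A) := (i == k) ==> (c == a).
pose Q' i (a c : B) := (i == k) ==> (c == a).
have famE (T : finType) (a0 : T) (f : {ffun 'I_n -> T}) :
    (f \in family (fun i c => (i == k) ==> (c == a0))) = (f k == a0).
  apply/familyP/idP => [/(_ k)|fk i]; first by rewrite unfold_in eqxx.
  by rewrite unfold_in; apply/implyP => /eqP ->.
transitivity (\sum_(f : {ffun 'I_n -> A} | f k == a) \sum_(g : {ffun 'I_n -> B} | g k == b)
    \prod_i G i (f i) (g i)).
  apply: eq_bigr => f /eqP fk; apply: eq_bigr => g /eqP gk; apply: eq_bigr => i _.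
  rewrite /G /= !ffunE; case: eqP => [->|//]; by rewrite fk gk.
transitivity (\prod_i \sum_(c | (i == k) ==> (c == a)) \sum_(d | (i == k) ==> (d == b)) G i c d).
  rewrite bigA_distr_big_dep /=; apply: eq_big => [f|f _]; first by rewrite famE.
  by rewrite bigA_distr_big_dep /=; apply: eq_bigl => g; rewrite famE.
rewrite (bigD1 k) //= [X in _ * X]big1 ?mulr1 => [|i /negbTE ik].
  rewrite eqxx /= (big_pred1 a) // (big_pred1 b) //.
  by rewrite /G eqxx.
have [_ _ <-] := st i; rewrite ik /= pair_big /trace /G ik.
by apply: eq_bigr => -[c d].
Qed.

End Products.

(** * Concatenation of blocks of copies *)

Section Joining.
Variable R : realType.
Local Notation C := R[i].

Section FiniteFunctions.
Variables (A : finType) (m n : nat).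

Definition joinf (p : {ffun 'I_m -> A} * {ffun 'I_n -> A}) : {ffun 'I_(m + n) -> A} :=
  [ffun i => match fintype.split i with inl a => p.1 a | inr b => p.2 b end].

Definition splitf (f : {ffun 'I_(m + n) -> A}) : {ffun 'I_m -> A} * {ffun 'I_n -> A} :=
  ([ffun i => f (lshift n i)], [ffun i => f (rshift m i)]).

Lemma joinf_lshift p i : joinf p (lshift n i) = p.1 i.
Proof. by rewrite ffunE (unsplitK (inl i)). Qed.

Lemma joinf_rshift p i : joinf p (rshift m i) = p.2 i.
Proof. by rewrite ffunE (unsplitK (inr i)). Qed.

Lemma joinfK : cancel joinf splitf.
Proof.
by move=> [f g]; congr (_, _); apply/ffunP => i; rewrite ffunE ?joinf_lshift ?joinf_rshift.
Qed.

Lemma splitfK : cancel splitf joinf.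
Proof.
move=> f; apply/ffunP => i; case: (split_ordP i) => j ->;
by rewrite ?joinf_lshift ?joinf_rshift ffunE.
Qed.

Lemma joinf_bij : bijective joinf.
Proof. exists splitf; [exact: joinfK|exact: splitfK]. Qed.

Lemma splitf_bij : bijective splitf.
Proof. exists joinf; [exact: splitfK|exact: joinfK]. Qed.

Lemma upd_joinf_lshift f g k a : upd (joinf (f, g)) (lshift n k) a = joinf (upd f k a, g).
Proof.
apply/ffunP => i; rewrite ffunE; case: (split_ordP i) => j ->.
  by rewrite !joinf_lshift /= ffunE (inj_eq (@lshift_inj _ _)).
by rewrite !joinf_rshift eq_rlshift.
Qed.

Lemma upd_joinf_rshift f g k a : upd (joinf (f, g)) (rshift m k) a = joinf (f, upd g k a).
Proof.
apply/ffunP => i; rewrite ffunE; case: (split_ordP i) => j ->.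
  by rewrite !joinf_lshift eq_lrshift.
by rewrite !joinf_rshift /= ffunE (inj_eq (@rshift_inj _ _)).
Qed.

Lemma sum_joinf_lshift (k : 'I_m) (P : pred A) (H : {ffun 'I_(m + n) -> A} -> C) :
  \sum_(f : {ffun 'I_(m + n) -> A} | P (f (lshift n k))) H f =
  \sum_(f : {ffun 'I_m -> A} | P (f k)) \sum_g H (joinf (f, g)).
Proof.
rewrite (reindex joinf); last exact/onW_bij/joinf_bij.
rewrite pair_big /=; apply: eq_big => [[f g]|[f g] _] //=.
by rewrite joinf_lshift andbT.
Qed.

Lemma sum_joinf_rshift (k : 'I_n) (P : pred A) (H : {ffun 'I_(m + n) -> A} -> C) :
  \sum_(f : {ffun 'I_(m + n) -> A} | P (f (rshift m k))) H f =
  \sum_(g : {ffun 'I_n -> A} | P (g k)) \sum_f H (joinf (f, g)).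
Proof.
rewrite (reindex joinf); last exact/onW_bij/joinf_bij.
rewrite exchange_big pair_big /=; apply: eq_big => [[f g]|[f g] _] //=.
by rewrite joinf_rshift.
Qed.

End FiniteFunctions.

Section Bipartite.
Variables (A B : finType) (m n : nat).

(** Lets a state of m + n copies be read as bipartite between the first m pairs and the last n
    pairs, so that marginals reduce to those of one block. *)
Definition joinAB (x : ({ffun 'I_m -> A} * {ffun 'I_m -> B}) *
    ({ffun 'I_n -> A} * {ffun 'I_n -> B})) :
    {ffun 'I_(m + n) -> A} * {ffun 'I_(m + n) -> B} :=
  (joinf (x.1.1, x.2.1), joinf (x.1.2, x.2.2)).

Definition splitAB (x : {ffun 'I_(m + n) -> A} * {ffun 'I_(m + n) -> B}) :=
  (((splitf x.1).1, (splitf x.2).1), ((splitf x.1).2, (splitf x.2).2)).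

Lemma joinABK : cancel joinAB splitAB.
Proof. by move=> [[f f'] [g g']]; rewrite /splitAB /joinAB !joinfK. Qed.

Lemma splitABK : cancel splitAB joinAB.
Proof.
move=> [F G]; congr (_, _); [exact: (splitfK F)|exact: (splitfK G)].
Qed.

Lemma joinAB_bij : bijective joinAB.
Proof. exists splitAB; [exact: joinABK|exact: splitABK]. Qed.

Lemma marg_lshift (sigma : op R (prod {ffun 'I_(m + n) -> A} {ffun 'I_(m + n) -> B})) k :
  marg sigma (lshift n k) = marg (trR (rx joinAB sigma)) k.
Proof.
apply/funext => -[a b]; apply/funext => -[a' b'].
rewrite /marg (sum_joinf_lshift k (pred1 a)) /=; apply: eq_bigr => f _.
under eq_bigr => g _ do rewrite (sum_joinf_lshift k (pred1 b)) /=.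
rewrite exchange_big; apply: eq_bigr => f' _ /=.
rewrite pair_big; apply: eq_bigr => -[g g'] _.
by rewrite !upd_joinf_lshift.
Qed.

Lemma marg_rshift (sigma : op R (prod {ffun 'I_(m + n) -> A} {ffun 'I_(m + n) -> B})) k :
  marg sigma (rshift m k) = marg (trL (rx joinAB sigma)) k.
Proof.
apply/funext => -[a b]; apply/funext => -[a' b'].
rewrite /marg (sum_joinf_rshift k (pred1 a)) /=; apply: eq_bigr => f _.
under eq_bigr => g _ do rewrite (sum_joinf_rshift k (pred1 b)) /=.
rewrite exchange_big; apply: eq_bigr => f' _ /=.
rewrite pair_big; apply: eq_bigr => -[g g'] _.
by rewrite !upd_joinf_rshift.
Qed.

End Bipartite.

Definition mapp (A A' B B' : Type) (f : A -> A') (g : B -> B') (x : A * B) : A' * B' :=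
  (f x.1, g x.2).

Lemma mapp_bij (A A' B B' : Type) (f : A -> A') (g : B -> B') :
  bijective f -> bijective g -> bijective (mapp f g).
Proof.
move=> [f' fK f'K] [g' gK g'K]; exists (mapp f' g') => -[a b];
by rewrite /mapp /= ?fK ?gK ?f'K ?g'K.
Qed.

Lemma trR_rx (A A' B B' : finType) (f : A' -> A) (g : B' -> B) (rho : op R (prod A B)) :
  bijective g -> trR (rx (mapp f g) rho) = rx f (trR rho).
Proof.
move=> bg; apply/funext => a; apply/funext => a'.
by rewrite /trR /rx [RHS](reindex g) //; exact: onW_bij.
Qed.

Lemma trL_rx (A A' B B' : finType) (f : A' -> A) (g : B' -> B) (rho : op R (prod A B)) :
  bijective f -> trL (rx (mapp f g) rho) = rx g (trL rho).
Proof.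
move=> bf; apply/funext => a; apply/funext => a'.
by rewrite /trL /rx [RHS](reindex f) //; exact: onW_bij.
Qed.

Lemma MI_rx (A A' B B' : finType) (f : A' -> A) (g : B' -> B) (rho : op R (prod A B)) :
  bijective f -> bijective g -> is_state rho -> MI (rx (mapp f g) rho) = MI rho.
Proof.
move=> bf bg sr; rewrite /MI trR_rx // trL_rx // !vN_rx //.
- exact: mapp_bij.
- exact: state_trL.
- exact: state_trR.
Qed.

Definition tens (A A' B B' : finType) (rho : op R (prod A B)) (rho' : op R (prod A' B')) :
  op R (prod (prod A A') (prod B B')) := regroup (kron rho rho').

Lemma state_MI_tens (A A' B B' : finType) (rho : op R (prod A B)) (rho' : op R (prod A' B')) :
  is_state rho -> is_state rho' ->
  is_state (tens rho rho') /\ MI (tens rho rho') = MI rho + MI rho'.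
Proof.
move=> sr sr'; have [sk vk] := state_vN_kron sr sr'.
pose f (x : (A * A') * (B * B')) := ((x.1.1, x.2.1), (x.1.2, x.2.2)).
have bf : bijective f.
  by exists (fun x => ((x.1.1, x.2.1), (x.1.2, x.2.2))) => [[[a a'] [b b']]|[[a b] [a' b']]].
split; first exact: (state_rx bf sk).
have vt : vN (tens rho rho') = vN rho + vN rho' by rewrite -vk; exact: (vN_rx bf sk).
have [_ vR] := state_vN_kron (state_trR sr) (state_trR sr').
have [_ vL] := state_vN_kron (state_trL sr) (state_trL sr').
have -> : MI (tens rho rho') = vN (kron (trR rho) (trR rho')) +
    vN (kron (trL rho) (trL rho')) - vN (tens rho rho').
  rewrite /MI; congr (_ + _ - _); congr vN.
    apply/funext => -[a b]; apply/funext => -[c d].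
    rewrite /trR /tens /regroup /kron /= mulr_suml -[LHS](pair_bigA _ (fun b b' =>
      rho (a, b) (c, b) * rho' (_, b') (_, b'))) /=.
    by apply: eq_bigr => e _; rewrite mulr_sumr.
  apply/funext => -[a b]; apply/funext => -[c d].
  rewrite /trL /tens /regroup /kron /= mulr_suml -[LHS](pair_bigA _ (fun b b' =>
      rho (b, a) (b, c) * rho' (b', _) (b', _))) /=.
  by apply: eq_bigr => e _; rewrite mulr_sumr.
by rewrite vR vL vt /MI; ring.
Qed.

Lemma trR_kron (S T : finType) (rho : op R S) (tau : op R T) :
  is_state tau -> trR (kron rho tau) = rho.
Proof.
move=> [_ _ t1]; apply/funext => x; apply/funext => y.
by rewrite /trR /kron /= -mulr_sumr -[X in _ * X]/(trace tau) t1 mulr1.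
Qed.

Lemma trL_kron (S T : finType) (rho : op R S) (tau : op R T) :
  is_state rho -> trL (kron rho tau) = tau.
Proof.
move=> [_ _ t1]; apply/funext => x; apply/funext => y.
by rewrite /trL /kron /= -mulr_suml -[X in X * _]/(trace rho) t1 mul1r.
Qed.

End Joining.

(** * Broadcast states *)

Section BroadcastBasics.
Variable R : realType.
Local Notation C := R[i].
Local Open Scope classical_set_scope.

Lemma Ib_n_le (A B : finType) (rho : op R (prod A B)) n
    (sigma : op R (prod {ffun 'I_n -> A} {ffun 'I_n -> B})) :
  is_broadcast rho sigma -> Ib_n rho n <= MI sigma.
Proof.
move=> bs; apply: ge_inf; last by exists sigma.
by exists 0 => _ [s [[ss _] ->]]; exact: MI_ge0.
Qed.

(** The product state is a broadcast state, so the infimum is over a nonempty set. *)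
Lemma Ib_n_ge (A B : finType) (rho : op R (prod A B)) n (c : R) : is_state rho ->
  (forall sigma : op R (prod {ffun 'I_n -> A} {ffun 'I_n -> B}),
     is_broadcast rho sigma -> c <= MI sigma) -> c <= Ib_n rho n.
Proof.
move=> sr H; apply: lb_le_inf; last by move=> _ [s [bs ->]]; exact: H.
exists (MI (prodop (fun _ : 'I_n => rho))), (prodop (fun=> rho)); split=> //.
split=> [|k]; first exact: state_prodop.
exact: marg_prodop.
Qed.

Lemma Ib_n_ge0 (A B : finType) (rho : op R (prod A B)) n : is_state rho ->
  0 <= Ib_n rho n.
Proof. by move=> sr; apply: Ib_n_ge => // s [ss _]; exact: MI_ge0. Qed.


Lemma rx_id (T T' : finType) (f : T' -> T) (g : T -> T') (rho : op R T) :
  cancel g f -> rx g (rx f rho) = rho.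
Proof. by move=> gK; apply/funext => x; apply/funext => y; rewrite /rx !gK. Qed.

Lemma broadcast_join (A B : finType) (rho : op R (prod A B)) m n
    (sigma : op R (prod {ffun 'I_m -> A} {ffun 'I_m -> B}))
    (tau : op R (prod {ffun 'I_n -> A} {ffun 'I_n -> B})) :
  is_broadcast rho sigma -> is_broadcast rho tau ->
  is_broadcast rho (rx (mapp (@splitf A m n) (@splitf B m n)) (tens sigma tau)).
Proof.
move=> [ss ms] [st mt]; split.
  apply: state_rx (proj1 (state_MI_tens ss st)); apply: mapp_bij; exact: splitf_bij.
have E : rx (@joinAB A B m n) (rx (mapp (@splitf A m n) (@splitf B m n)) (tens sigma tau))
    = kron sigma tau.
  have -> : rx (mapp (@splitf A m n) (@splitf B m n)) (tens sigma tau)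
    = rx (@splitAB A B m n) (kron sigma tau) by [].
  by rewrite rx_id //; exact: joinABK.
move=> k; case: (split_ordP k) => j ->.
  by rewrite marg_lshift E trR_kron.
by rewrite marg_rshift E trL_kron.
Qed.

Lemma Ib_n_subadd (A B : finType) (rho : op R (prod A B)) m n : is_state rho ->
  Ib_n rho (m + n) <= Ib_n rho m + Ib_n rho n.
Proof.
move=> sr; rewrite -lerBlDr; apply: Ib_n_ge => // s bs.
rewrite lerBlDr addrC -lerBlDr; apply: Ib_n_ge => // t bt; rewrite lerBlDr.
have [sst mst] := state_MI_tens (proj1 bs) (proj1 bt).
have := Ib_n_le (broadcast_join bs bt); rewrite MI_rx ?mst 1?[MI t + _]addrC //.
- exact: splitf_bij.
- exact: splitf_bij.
Qed.

Lemma EI_set_lb (A B : finType) (rho : op R (prod A B)) :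
  lbound [set x : R | exists (A' B' : finType) (sigma : op R (prod (prod A B) (prod A' B'))),
         is_ext rho sigma /\ x = EI_obj sigma] 0.
Proof.
move=> _ [A' [B' [s [[ss _] ->]]]].
exact: le_trans (sq_obj_ge0 ss) (sq_obj_le_EI_obj ss).
Qed.

Lemma EI_le (A B A' B' : finType) (rho : op R (prod A B))
    (sigma : op R (prod (prod A B) (prod A' B'))) :
  is_ext rho sigma -> 2 * EI rho <= EI_obj sigma.
Proof.
move=> es; rewrite /EI mulrC divfK ?pnatr_eq0 //; apply: ge_inf.
  by exists 0; exact: EI_set_lb.
by exists A', B', sigma.
Qed.

Lemma EsqQ_le_EI (A B : finType) (rho : op R (prod A B)) : is_state rho ->
  2 * EsqQ rho <= 2 * EI rho.
Proof.
move=> sr; rewrite /EsqQ /EI ![2 * _]mulrC !divfK ?pnatr_eq0 //.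
apply: lb_le_inf; last first.
  move=> _ [A' [B' [s [es ->]]]].
  apply: le_trans (sq_obj_le_EI_obj (proj1 es)); apply: ge_inf.
    by exists 0 => _ [E [t [[st _] ->]]]; exact: sq_obj_ge0.
  by exists (A' * B')%type, s.
(* The extension by trivial systems shows that the infimum defining [EI] is over a nonempty set. *)
pose f (x : (A * B) * (unit * unit)) := x.1.
have bf : bijective f.
  by exists (fun x => (x, (tt, tt))) => [[x [[] []]]|x].
exists (EI_obj (rx f rho)), unit, unit, (rx f rho); split=> //; split.
  exact: state_rx.
apply/funext => x; apply/funext => y; rewrite /trR /rx /f /=.
by rewrite (big_pred1 (tt, tt)) // => -[[] []].
Qed.

Definition const1 (A : finType) (a : A) : {ffun 'I_1 -> A} := [ffun=> a].

Lemma const1_bij (A : finType) : bijective (@const1 A).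
Proof.
exists (fun f : {ffun 'I_1 -> A} => f ord0) => [a|f]; first by rewrite ffunE.
by apply/ffunP => i; rewrite ffunE (ord1 i).
Qed.

Lemma marg_ord1 (A B : finType) (sigma : op R (prod {ffun 'I_1 -> A} {ffun 'I_1 -> B})) :
  marg sigma ord0 = rx (mapp (@const1 A) (@const1 B)) sigma.
Proof.
have c1 (T : finType) (a : T) (f : {ffun 'I_1 -> T}) : (f ord0 == a) = (f == const1 a).
  apply/eqP/eqP => [fa|->]; last by rewrite ffunE.
  by apply/ffunP => i; rewrite ffunE (ord1 i).
have u1 (T : finType) (a b : T) : upd (const1 a) ord0 b = const1 b.
  by apply/ffunP => i; rewrite !ffunE (ord1 i) eqxx.
apply/funext => -[a b]; apply/funext => -[a' b'].
rewrite /marg (big_pred1 (const1 a)) => [|f]; last exact: c1.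
rewrite (big_pred1 (const1 b)) => [|f]; last exact: c1.
by rewrite !u1.
Qed.

(* One position of a broadcast state is peeled off: the remaining ones form an
   extension A'B' of its marginal. *)
Lemma Ib_n_peel (A B : finType) (rho : op R (prod A B)) n : is_state rho ->
  2 * EI rho + Ib_n rho n <= Ib_n rho n.+1.
Proof.
move=> sr; apply: Ib_n_ge => // sigma0; rewrite -[n.+1]/(1 + n)%N => -[ss ms].
set sigma : op R (prod {ffun 'I_(1 + n) -> A} {ffun 'I_(1 + n) -> B}) := sigma0.
pose s1 := rx (@joinAB A B 1 n) sigma.
have ss1 : is_state s1 by apply: state_rx => //; exact: joinAB_bij.
pose c := mapp (mapp (@const1 A) (@const1 B)) (@id ({ffun 'I_n -> A} * {ffun 'I_n -> B})).
pose s2 := rx c s1.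
have bid (T : Type) : bijective (@id T) by exists id.
have bc1 : bijective (mapp (@const1 A) (@const1 B)).
  by apply: mapp_bij; exact: const1_bij.
have bc : bijective c by apply: mapp_bij.
have ss2 : is_state s2 by apply: state_rx.
have e2 : is_ext rho s2.
  split=> //; rewrite /s2 /c trR_rx // -marg_ord1 -(ms (lshift n ord0)).
  by rewrite [RHS](marg_lshift sigma).
have l2 : trL s2 = trL s1 by rewrite /s2 /c trL_rx.
have b2 : is_broadcast rho (trL s2).
  split; first exact: state_trL.
  by move=> k; rewrite l2 /s1 -marg_rshift.
have m2 : MI (regroup s2) = MI sigma.
  pose g (T : finType) := fun x : T * {ffun 'I_n -> T} => joinf (const1 x.1, x.2).
  have bg T : bijective (g T).
    apply: (@bij_comp _ _ _ (@joinf T 1 n) (mapp (@const1 T) id)).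
      exact: joinf_bij.
    by apply: mapp_bij => //; exact: const1_bij.
  by rewrite -(MI_rx (bg A) (bg B)).
(* The objective is I(sigma) minus the mutual information of the other n positions, which themselves
   form a broadcast state. *)
have := EI_le e2; rewrite /EI_obj m2.
have := Ib_n_le b2; lra.
Qed.

Lemma EI_le_Ib_n (A B : finType) (rho : op R (prod A B)) n : is_state rho ->
  n%:R * (2 * EI rho) <= Ib_n rho n.
Proof.
move=> sr; elim: n => [|n IH]; first by rewrite mul0r Ib_n_ge0.
apply: le_trans (Ib_n_peel n sr); rewrite -natr1 mulrDl mul1r addrC.
by rewrite lerD2l.
Qed.

End BroadcastBasics.

(** * Blocks of m copies as single copies of the m-fold power *)

Section Currying.
Variable R : realType.
Local Notation C := R[i].
Variables (A B : finType) (n m : nat).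

(** [mxvec_index] serves as the bijection between pairs (i, j), block and place in the block, and
    positions in ['I_(n * m)]. *)
Definition curf (T : finType) (F : {ffun 'I_(n * m) -> T}) :
  {ffun 'I_n -> {ffun 'I_m -> T}} := [ffun i => [ffun j => F (mxvec_index i j)]].

Lemma curf_bij (T : finType) : bijective (@curf T).
Proof.
apply: inj_card_bij => [F G FG|].
  apply/ffunP => k; case/mxvec_indexP: k => i j.
  by move/ffunP/(_ i)/ffunP/(_ j): FG; rewrite !ffunE.
by rewrite !card_ffun !card_ord -expnM mulnC.
Qed.

Lemma eq_mxvec_index (i i' : 'I_n) (j j' : 'I_m) :
  (mxvec_index i j == mxvec_index i' j') = (i == i') && (j == j').
Proof.
apply/eqP/andP => [E|[/eqP-> /eqP->] //].
have [u uK _] := curry_mxvec_bij n m.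
have := uK (i, j) isT; have := uK (i', j') isT; rewrite /= E => -> [-> ->].
by rewrite !eqxx.
Qed.

Lemma curf_upd (T : finType) (F : {ffun 'I_(n * m) -> T}) i j a :
  curf (upd F (mxvec_index i j) a) = upd (curf F) i (upd (curf F i) j a).
Proof.
apply/ffunP => i'; rewrite !ffunE; case: eqP => [->|/eqP/negbTE ni];
  apply/ffunP => j'; rewrite !ffunE eq_mxvec_index ?eqxx ?ni //=.
Qed.

Lemma sum_fiber (T : finType) (i : 'I_n) (P : pred T) (H : T -> {ffun 'I_n -> T} -> C) :
  \sum_(f | P f) \sum_(F : {ffun 'I_n -> T} | F i == f) H f F =
  \sum_(F : {ffun 'I_n -> T} | P (F i)) H (F i) F.
Proof.
rewrite [RHS](partition_big (fun F : {ffun 'I_n -> T} => F i) P) //=.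
apply: eq_bigr => f Pf; apply: eq_big => [F|F /eqP -> //].
by case: eqP => [->|]; rewrite ?Pf ?andbF.
Qed.

Lemma marg_curf (sigma : op R (prod {ffun 'I_n -> {ffun 'I_m -> A}}
                                   {ffun 'I_n -> {ffun 'I_m -> B}})) i j :
  marg (rx (mapp (@curf A) (@curf B)) sigma) (mxvec_index i j) = marg (marg sigma i) j.
Proof.
apply/funext => -[a b]; apply/funext => -[a' b'].
rewrite /marg /rx /mapp /=.
under [LHS]eq_bigr => F _ do under eq_bigr => G _ do rewrite !curf_upd.
pose H (f : {ffun 'I_m -> A}) F (g : {ffun 'I_m -> B}) G :=
  sigma (F, G) (upd F i (upd f j a'), upd G i (upd g j b')).
transitivity (\sum_(F : {ffun 'I_n -> {ffun 'I_m -> A}} | F i j == a)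
  \sum_(G : {ffun 'I_n -> {ffun 'I_m -> B}} | G i j == b) H (F i) F (G i) G).
  rewrite [RHS](reindex (@curf A)); last exact/onW_bij/curf_bij.
  apply: eq_big => [F|F _]; first by rewrite !ffunE.
  rewrite [RHS](reindex (@curf B)); last exact/onW_bij/curf_bij.
  by apply: eq_big => [G|G _ //]; rewrite !ffunE.
rewrite -(sum_fiber i (fun f : {ffun 'I_m -> A} => f j == a) (fun f F =>
  \sum_(G : {ffun 'I_n -> {ffun 'I_m -> B}} | G i j == b) H f F (G i) G)).
apply: eq_bigr => f _ /=.
under eq_bigr => F _ do rewrite -(sum_fiber i (fun g : {ffun 'I_m -> B} => g j == b)
  (fun g G => H f F g G)).
by rewrite exchange_big.
Qed.

End Currying.

(** * Broadcast states from decompositions, by cyclic shifts *)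

Section CyclicBroadcast.
Variable R : realType.
Local Notation C := R[i].
Variables (A B : finType).
Implicit Types rho : op R (prod A B).

(** An n-copy broadcast state of the m-fold power is, with the same cut, an nm-copy broadcast state
    of [rho], since every place of a block has marginal [rho]. *)
Lemma Ib_n_tpow rho n m : is_state rho ->
  Ib_n rho (n * m) <= Ib_n (tpow (n := m) rho) n.
Proof.
move=> sr; apply: Ib_n_ge => [|sigma [ss ms]]; first exact: (state_prodop (fun _ : 'I_m => sr)).
rewrite -(MI_rx (@curf_bij n m A) (@curf_bij n m B) ss); apply: Ib_n_le; split.
  by apply: state_rx => //; apply: mapp_bij; exact: curf_bij.
move=> k; case/mxvec_indexP: k => i j; rewrite marg_curf ms.
exact: marg_prodop.
Qed.

Lemma marg_mix (K : finType) (p : K -> R) n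
    (sig : K -> op R (prod {ffun 'I_n -> A} {ffun 'I_n -> B})) k :
  marg (mix p sig) k = mix p (fun s => marg (sig s) k).
Proof.
apply/funext => x; apply/funext => y; rewrite /marg /mix.
under [LHS]eq_bigr => f _ do rewrite exchange_big.
rewrite exchange_big; apply: eq_bigr => s _ /=; rewrite mulr_sumr.
by apply: eq_bigr => f _; rewrite mulr_sumr.
Qed.

Lemma prob_unif n : prob (fun _ : 'I_n.+1 => n.+1%:R^-1 : R).
Proof.
split=> [i|]; first by rewrite invr_ge0.
by rewrite sumr_const card_ord -[LHS]mulr_natl divff // pnatr_eq0.
Qed.

Lemma shannon2_unif n :
  shannon2 (fun _ : 'I_n.+1 => n.+1%:R^-1 : R) = ln n.+1%:R / ln 2.
Proof.
rewrite shannon2E -mulr_suml (proj2 (prob_unif n)) mul1r lnV ?opprK //.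
by rewrite posrE ltr0n.
Qed.

(* A mixture over the cyclic shifts has the right marginals everywhere, while
   involving so few terms that the mixing costs only O(log n). *)
Lemma Ib_n_le_cyclic rho n (tau : 'I_n.+1 -> op R (prod A B)) :
  (forall i, is_state (tau i)) -> mix (fun=> n.+1%:R^-1) tau = rho ->
  Ib_n rho n.+1 <= \sum_i MI (tau i) + 2 * (ln n.+1%:R / ln 2).
Proof.
move=> st mt; pose sig (s : 'I_n.+1) := prodop (fun i => tau (i + s)).
have ssig s : is_state (sig s) by apply: state_prodop.
have pu := prob_unif n.
apply: (@le_trans _ _ (MI (mix (fun=> n.+1%:R^-1) sig))).
  apply: Ib_n_le; split; first exact: state_mix.
  move=> k; rewrite marg_mix -mt; apply/funext => x; apply/funext => y.
  (* Addition in ['I_n.+1] is modulo n + 1, so s -> k + s permutes the positions and the marginal at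
     k is the average of all [tau i]. *)
  rewrite /mix [RHS](reindex_inj (@addrI _ k)) /=.
  by apply: eq_bigr => s _; rewrite marg_prodop.
apply: le_trans (MI_mix_le pu ssig) _; rewrite shannon2_unif lerD2r.
have -> : \sum_k n.+1%:R^-1 * MI (sig k) = \sum_(k < n.+1) n.+1%:R^-1 * \sum_i MI (tau i).
  apply: eq_bigr => s _; rewrite MI_prodop //.
  by rewrite [in RHS](reindex_inj (@addIr _ s)).
by rewrite -mulr_suml (proj2 pu) mul1r.
Qed.

Lemma natrC n : n%:R = (n%:R : R)%:C%C :> C.
Proof. by rewrite rmorph_nat. Qed.

(** The first error term charges each of the at most |K| correction positions with the trivial bound
    on mutual information; the second is the cost of the shifts. *)
Lemma Ib_n_le_decomp (K : finType) (p : K -> R) (sig : K -> op R (prod A B)) rho n :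
  is_state rho -> prob p -> (forall k, is_state (sig k)) -> mix p sig = rho ->
  Ib_n rho n.+1 <= n.+1%:R * \sum_k p k * MI (sig k)
    + #|K|%:R * ((#|A| + #|B|)%:R / ln 2) + 2 * (ln n.+1%:R / ln 2).
Proof.
move=> sr [p0 p1] ss mE; set N : R := n.+1%:R; set c := (#|A| + #|B|)%:R / ln 2.
have N0 : 0 < N by rewrite ltr0n.
have c0 : 0 <= c by rewrite divr_ge0 // ltW // ln2_gt0.
pose nk k := Num.truncn (N * p k).
have nk_le k : (nk k)%:R <= N * p k by rewrite truncn_le mulr_ge0 // ltW.
have nk_gt k : N * p k < (nk k)%:R + 1 by rewrite natr1 truncnS_gt.
pose S := (\sum_k nk k)%N.
have NE : N = \sum_k N * p k by rewrite -mulr_sumr p1 mulr1.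
have SN : (S <= n.+1)%N.
  by rewrite -(ler_nat R) natr_sum -/N NE; apply: ler_sum.
pose r := (n.+1 - S)%N.
have rE : r%:R = \sum_k (N * p k - (nk k)%:R).
  by rewrite /r natrB // -/N natr_sum sumrB -NE.
have rK : r%:R <= #|K|%:R :> R.
  rewrite rE -sum1_card natr_sum; apply: ler_sum => k _.
  by rewrite lerBlDr addrC ltW.
(* The fractional parts lost by truncation sum to r; normalised, they are the weights of one state
   [tau0] which, placed r times, restores the average exactly. If r = 0 nothing is lost and [tau0]
   is a placeholder. *)
pose q k := (N * p k - (nk k)%:R) / r%:R.
pose tau0 := if r == 0%N then rho else mix q sig.
have st0 : is_state tau0.
  rewrite /tau0; case: eqP => // /eqP r0; apply: state_mix => //; split=> [k|].
    by rewrite divr_ge0 // subr_ge0.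
  by rewrite -mulr_suml -rE divff // pnatr_eq0.
have t0E x y : tau0 x y *+ r = \sum_k (N * p k - (nk k)%:R)%:C%C * sig k x y.
  rewrite /tau0; have [r0|r0] := eqVneq r 0%N.
    rewrite r0 mulr0n big1 // => k _.
    suff -> : N * p k - (nk k)%:R = 0 by rewrite mul0r.
    apply/eqP; rewrite eq_le subr_ge0 nk_le andbT.
    have : r%:R = 0 :> R by rewrite r0.
    by rewrite rE => <-; rewrite (bigD1 k) //= lerDl sumr_ge0 // => j _; rewrite subr_ge0.
  rewrite /mix -mulr_natl mulr_sumr; apply: eq_bigr => k _.
  rewrite mulrA; congr (_ * _); rewrite natrC -rmorphM /=.
  by rewrite /q mulrC divfK // pnatr_eq0.
(* The labels of the n + 1 positions: [Some k] occurs [nk k] times, and [None] marks the r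
   correction positions. *)
pose l : seq (option K) := flatten [seq nseq (nk k) (Some k) | k <- enum K] ++ nseq r None.
have sl : size l = n.+1.
  rewrite size_cat size_nseq size_flatten /shape -map_comp sumnE big_map big_enum /=.
  by under eq_bigr do rewrite size_nseq; rewrite -/S subnKC.
pose G o := if o is Some k then sig k else tau0.
pose tau (i : 'I_n.+1) := G (nth None l i).
have stau i : is_state (tau i) by rewrite /tau /G; case: nth.
have sumE (V : nmodType) (F : option K -> V) :
    \sum_(i < n.+1) F (nth None l i) = \sum_k F (Some k) *+ nk k + F None *+ r.
  rewrite -sl -(big_mkord xpredT (fun i => F (nth None l i))) -(big_nth None xpredT F).
  rewrite big_cat big_flatten big_map big_enum /= big_nseq GRing.iter_addr_0.
  by congr (_ + _); apply: eq_bigr => k _; rewrite big_nseq GRing.iter_addr_0.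
have mtau : mix (fun=> N^-1) tau = rho.
  rewrite -mE; apply/funext => x; apply/funext => y.
  rewrite /mix -mulr_sumr (sumE _ (fun o => G o x y)) /= t0E -big_split /= mulr_sumr.
  apply: eq_bigr => k _; rewrite -[sig k x y *+ _]mulr_natl natrC -mulrDl -rmorphD.
  rewrite mulrA -rmorphM /=.
  by congr (_%:C%C * _); rewrite addrC subrK mulrA mulVf ?mul1r // gt_eqF.
apply: le_trans (Ib_n_le_cyclic stau mtau) _; rewrite lerD2r (sumE _ (fun o => MI (G o))) lerD //.
  rewrite mulr_sumr; apply: ler_sum => k _; rewrite mulrA -mulr_natl /=.
  by rewrite ler_wpM2r // MI_ge0.
rewrite /= -[_ *+ r]mulr_natl; apply: le_trans (_ : r%:R * c <= _).
  by rewrite ler_wpM2l // MI_le.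
by rewrite ler_wpM2r.
Qed.

End CyclicBroadcast.

(** * The classical squashed entanglement *)

Section ClassicalSquashed.
Variable R : realType.
Local Notation C := R[i].
Local Open Scope classical_set_scope.

Lemma EsqC_le (A B K : finType) (rho : op R (prod A B)) (p : K -> R)
    (sig : K -> op R (prod A B)) :
  prob p -> (forall k, is_state (sig k)) -> mix p sig = rho ->
  2 * EsqC rho <= \sum_k p k * MI (sig k).
Proof.
move=> pp ss mE; rewrite /EsqC mulrC divfK ?pnatr_eq0 //; apply: ge_inf.
  exists 0 => _ [K' [p' [sig' [p0 p1 ss' _ ->]]]].
  by rewrite sq_obj_ge0 //; exact: state_cq.
exists K, p, sig; split=> //; [exact: pp.1|exact: pp.2| |by rewrite sq_obj_cq].
by split; [exact: state_cq|rewrite -mE -trR_cq].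
Qed.

(** The one-term decomposition makes the set nonempty. Together with [EsqC_le] this replaces flagged
    extensions by plain decompositions in all later arguments. *)
Lemma EsqC_ge (A B : finType) (rho : op R (prod A B)) (c : R) : is_state rho ->
  (forall (K : finType) (p : K -> R) (sig : K -> op R (prod A B)), prob p ->
     (forall k, is_state (sig k)) -> mix p sig = rho ->
     c <= \sum_k p k * MI (sig k)) -> c <= 2 * EsqC rho.
Proof.
move=> sr H; rewrite /EsqC mulrC divfK ?pnatr_eq0 //; apply: lb_le_inf.
  pose p (_ : unit) : R := 1; pose sig (_ : unit) := rho.
  have p1 : \sum_k p k = 1 by rewrite sumr_const card_unit.
  have pp : prob p by split=> [k|//]; exact: ler01.
  exists (sq_obj (cq_state p sig)), unit, p, sig; split=> //.
  split; first exact: state_cq.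
  rewrite [LHS](trR_cq p sig); apply/funext => x; apply/funext => y.
  by rewrite /mix (big_pred1 tt) ?mul1r // => -[].
move=> _ [K [p [sig [p0 p1 ss [sc tc] ->]]]].
have pp : prob p by [].
by rewrite sq_obj_cq //; apply: H => //; rewrite -trR_cq.
Qed.

Lemma EsqC_ge0 (A B : finType) (rho : op R (prod A B)) : is_state rho ->
  0 <= EsqC rho.
Proof.
move=> sr; rewrite -(pmulr_rge0 _ (ltr0n R 2)); apply: EsqC_ge => // K p sig pp ss _.
by apply: sumr_ge0 => k _; rewrite mulr_ge0 ?(proj1 pp) // MI_ge0.
Qed.

Lemma EsqC_rx (A A' B B' : finType) (f : A' -> A) (g : B' -> B)
    (rho : op R (prod A B)) : bijective f -> bijective g -> is_state rho ->
  2 * EsqC (rx (mapp f g) rho) <= 2 * EsqC rho.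
Proof.
move=> bf bg sr; apply: EsqC_ge => // K p sig pp ss mE.
have -> : \sum_k p k * MI (sig k) = \sum_k p k * MI (rx (mapp f g) (sig k)).
  by apply: eq_bigr => k _; rewrite MI_rx.
apply: EsqC_le => //; last by rewrite -mE.
by move=> k; apply: state_rx => //; exact: mapp_bij.
Qed.

(** Products of decompositions have weights p_k p'_l, and the mutual information is additive on
    their members. *)
Lemma EsqC_tens (A A' B B' : finType) (rho : op R (prod A B))
    (rho' : op R (prod A' B')) : is_state rho -> is_state rho' ->
  2 * EsqC (tens rho rho') <= 2 * EsqC rho + 2 * EsqC rho'.
Proof.
move=> sr sr'; rewrite -lerBlDr; apply: EsqC_ge => // K p sig pp ss mE.
rewrite lerBlDr addrC -lerBlDr; apply: EsqC_ge => // K' p' sig' pp' ss' mE'.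
rewrite lerBlDr.
pose q (k : K * K') := p k.1 * p' k.2.
have sk k l := state_MI_tens (ss k) (ss' l).
have sumq (F : K -> R) (F' : K' -> R) :
    \sum_k q k * (F k.1 + F' k.2) = \sum_k p k * F k + \sum_l p' l * F' l.
  rewrite -(pair_bigA _ (fun k l => p k * p' l * (F k + F' l))) /=.
  transitivity (\sum_k \sum_l (p k * F k * p' l + p k * (p' l * F' l))).
    by apply: eq_bigr => k _; apply: eq_bigr => l _; ring.
  transitivity (\sum_k (p k * F k + p k * \sum_l p' l * F' l)).
    apply: eq_bigr => k _.
    by rewrite big_split -!mulr_sumr /= (proj2 pp') mulr1.
  by rewrite big_split /= -mulr_suml (proj2 pp) mul1r.
have pq : prob q.
  split=> [k|]; first by rewrite mulr_ge0 ?(proj1 pp) ?(proj1 pp').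
  rewrite -(pair_bigA _ (fun k l => p k * p' l)) /=.
  under eq_bigr => k _ do rewrite -mulr_sumr (proj2 pp') mulr1.
  exact: (proj2 pp).
have := @EsqC_le _ _ _ (tens rho rho') q (fun k => tens (sig k.1) (sig' k.2)) pq.
rewrite [X in _ -> _ -> _ <= X](eq_bigr (fun k => q k *
  (MI (sig k.1) + MI (sig' k.2)))); last first.
  by move=> k _; rewrite (proj2 (sk _ _)).
rewrite (sumq (fun k => MI (sig k)) (fun l => MI (sig' l))) [X in _ <= X]addrC; apply.
  by move=> k; case: (sk k.1 k.2).
rewrite -mE -mE'; apply/funext => x; apply/funext => y.
rewrite /tens /regroup /kron /mix /= mulr_suml -(pair_bigA _ (fun k l =>
  (p k * p' l)%:C%C * (sig k _ _ * sig' l _ _))) /=.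
apply: eq_bigr => k _; rewrite mulr_sumr; apply: eq_bigr => l _.
by rewrite rmorphM; ring.
Qed.

Lemma state_tpow (A B : finType) (rho : op R (prod A B)) n : is_state rho ->
  is_state (tpow (n := n) rho).
Proof. by move=> sr; exact: (state_prodop (fun _ : 'I_n => sr)). Qed.

Lemma EsqC_tpow_subadd (A B : finType) (rho : op R (prod A B)) m n : is_state rho ->
  EsqC (tpow (n := m + n) rho) <= EsqC (tpow (n := m) rho) + EsqC (tpow (n := n) rho).
Proof.
move=> sr; rewrite -(ler_pM2l (ltr0n R 2)) mulrDr.
have [sm sn] := (state_tpow m sr, state_tpow n sr).
apply: le_trans (EsqC_tens sm sn).
have -> : tpow (n := m + n) rho = rx (mapp (@splitf A m n) (@splitf B m n))
    (tens (tpow (n := m) rho) (tpow (n := n) rho)).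
  apply/funext => x; apply/funext => y; rewrite /tpow big_split_ord.
  by congr (_ * _); apply: eq_bigr => i _; rewrite /= !ffunE.
apply: EsqC_rx; [exact: splitf_bij|exact: splitf_bij|].
exact: (proj1 (state_MI_tens sm sn)).
Qed.

Lemma EsqC_tpow1 (A B : finType) (rho : op R (prod A B)) : is_state rho ->
  2 * EsqC (tpow (n := 1) rho) <= 2 * EsqC rho.
Proof.
move=> sr; pose ev (T : finType) (f : {ffun 'I_1 -> T}) := f ord0.
have bev T : bijective (ev T).
  by exists (@const1 T) => [f|a]; rewrite /ev ?ffunE //; apply/ffunP => i; rewrite ffunE (ord1 i).
have -> : tpow (n := 1) rho = rx (mapp (ev A) (ev B)) rho.
  by apply/funext => x; apply/funext => y; rewrite /tpow big_ord1.
exact: EsqC_rx.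
Qed.

Lemma EsqC_seq_cvg (A B : finType) (rho : op R (prod A B)) : is_state rho ->
  cvgn (EsqC_seq rho) /\ (forall m, (0 < m)%N -> EsqC_reg rho <= EsqC_seq rho m).
Proof.
move=> sr; apply: (@fekete R (fun n => EsqC (tpow (n := n) rho))) => [n|m n].
  by apply: EsqC_ge0; exact: state_tpow.
exact: EsqC_tpow_subadd.
Qed.

Lemma Ib_seq_cvg (A B : finType) (rho : op R (prod A B)) : is_state rho ->
  cvgn (Ib_seq rho) /\ (forall m, (0 < m)%N -> Ib_reg rho <= Ib_seq rho m).
Proof.
move=> sr; apply: (@fekete R (Ib_n rho)) => [n|m n]; first exact: Ib_n_ge0.
exact: Ib_n_subadd.
Qed.

(** For a fixed decomposition of the m-fold power with average S, nm-copy broadcast states give nm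
    [Ib_reg] <= n S + O(log n); dividing by n and letting n grow removes the error. *)
Lemma Ib_reg_le_EsqC_tpow (A B : finType) (rho : op R (prod A B)) m : is_state rho ->
  (0 < m)%N -> m%:R * Ib_reg rho <= 2 * EsqC (tpow (n := m) rho).
Proof.
move=> sr m0; have st := state_tpow m sr.
apply: EsqC_ge => // K p sig pp ss mE.
set S := \sum_k _.
set D : R := (#|{ffun 'I_m -> A}| + #|{ffun 'I_m -> B}|)%:R / ln 2.
have m0R : 0 < m%:R :> R by rewrite ltr0n.
rewrite -subr_le0; apply: (@sublinear_bound R _ (#|K|%:R * D) (2 / ln 2)).
  by rewrite divr_ge0 // ltW // ln2_gt0.
case=> // n _; have n0 : 0 < n.+1%:R :> R by rewrite ltr0n.
rewrite ler_pdivlMr // mulrBl lerBlDr.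
have := proj2 (Ib_seq_cvg sr) (n.+1 * m)%N; rewrite muln_gt0 m0 => /(_ isT).
rewrite /Ib_seq ler_pdivlMr; last by rewrite ltr0n muln_gt0 m0.
move=> H; have := le_trans H (Ib_n_tpow n.+1 m sr).
have := Ib_n_le_decomp n st pp ss mE; rewrite -/S -/D natrM.
set L := ln n.+1%:R; have -> : 2 * (L / ln 2) = 2 / ln 2 * L by ring.
move=> H1 H2; have := le_trans H2 H1; lra.
Qed.

End ClassicalSquashed.

Unset Implicit Arguments.

(** Convergence is part of the conclusion so that both uses of [limn] denote genuine limits. *)
Theorem theorem3 (R : realType) (A B : finType) (rho : op R (prod A B)) :
  is_state rho ->
  [/\ cvgn (EsqC_seq rho), cvgn (Ib_seq rho) &
   [/\ 2 * EsqC rho >= 2 * EsqC_reg rho,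
      2 * EsqC_reg rho >= Ib_reg rho,
      Ib_reg rho >= 2 * EI rho
    & 2 * EI rho >= 2 * EsqQ rho]].
Proof.
move=> sr.
have [cE reg_le] := EsqC_seq_cvg sr; have [cI _] := Ib_seq_cvg sr.
split=> //; split.
- apply: le_trans (EsqC_tpow1 sr); rewrite ler_pM2l //.
  by have := reg_le 1%N isT; rewrite /EsqC_seq divr1.
- rewrite mulrC -ler_pdivrMr //; apply: limr_ge => //.
  (* Only n > 0 carries information: at n = 0 the division by 0 makes the term of the sequence 0. *)
  near=> n; have n0 : (0 < n)%N by near: n; exact: nbhs_infty_gt.
  rewrite /EsqC_seq ler_pdivlMr ?ltr0n // mulrAC ler_pdivrMr // mulrC.
  by rewrite [_ * 2]mulrC; exact: Ib_reg_le_EsqC_tpow.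
- apply: limr_ge => //.
  near=> n; have n0 : (0 < n)%N by near: n; exact: nbhs_infty_gt.
  by rewrite /Ib_seq ler_pdivlMr ?ltr0n // mulrC EI_le_Ib_n.
- exact: EsqQ_le_EI.
Unshelve. all: by end_near.
Qed.
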